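(* Let $R$ be a ring such that the class $\mathcal{GF}_{ac}$ of Gorenstein AC-flat $R$-modules is closed under extensions. Then $\mathcal{GF}_{ac}$ is covering.
   Context: Rings are associative and unital; $R$-module means left $R$-module. $\mathrm{FP}_\infty$ is the class of modules having a resolution by finitely generated projective modules. A right $R$-module $A$ is absolutely clean if $\mathrm{Ext}^1_R(F,A)=0$ for all right $R$-modules $F\in\mathrm{FP}_\infty$. An $R$-module $M$ is Gorenstein AC-flat if there is an exact complex of flat modules $\mathbf F=\cdots\to F_1\to F_0\to F_{-1}\to\cdots$ such that $A\otimes_R\mathbf F$ is exact for every absolutely clean right $R$-module $A$ and $M$ is one of the cycles of $\mathbf F$. For a class $\mathcal X$ of modules, an $\mathcal X$-precover of $M$ is a map $\varphi\colon X\to M$ with $X\in\mathcal X$ such that every map $X'\to M$ with $X'\in\mathcal X$ factors through $\varphi$; it is an $\mathcal X$-cover if moreover every endomorphism $f$ of $X$ with $\varphi f=\varphi$ is an automorphism. $\mathcal X$ is covering if every module has an $\mathcal X$-cover. *)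

(* Defs.v *)
From HB Require Import structures.
From mathcomp Require Import all_boot all_algebra.
From mathcomp Require Import boolp.
From mathcomp Require Import freeg.

Set Implicit Arguments.
Unset Strict Implicit.
Unset Printing Implicit Defensive.

Import GRing.Theory.
Local Open Scope ring_scope.
Local Open Scope quotient_scope.

(* Left R-modules are [lmodType R]; right R-modules are left modules over the
   converse ring, [lmodType R^c], with [r *: a] standing for a r.  Rings are
   [pzRingType]s, so that the zero ring is allowed. *)

Definition exact (U V W : zmodType) (f : U -> V) (g : V -> W) : Prop :=
  forall v : V, g v = 0 <-> exists u : U, f u = v.

Definition surj (U V : Type) (f : U -> V) : Prop :=
  forall v : V, exists u : U, f u = v.

Section Modules.
Variable R : pzRingType.
Implicit Types M N : lmodType R.

Definition projective (P : lmodType R) : Prop :=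
  forall (M N : lmodType R) (g : {linear M -> N}) (f : {linear P -> N}),
    surj g -> exists h : {linear P -> M}, forall x, g (h x) = f x.

Definition fin_generated M : Prop :=
  exists (n : nat) (v : 'I_n -> M),
    forall x : M, exists c : 'I_n -> R, x = \sum_(i < n) c i *: v i.

(* An exact sequence ... -> P 2 -> P 1 -> P 0 -> M -> 0. *)
Record resolution M := Resolution {
  res_obj :> nat -> lmodType R;
  res_d : forall n, {linear res_obj n.+1 -> res_obj n};
  res_aug : {linear res_obj 0 -> M};
  res_exact : forall n, exact (res_d n.+1) (res_d n);
  res_exact0 : exact (res_d 0) res_aug;
  res_surj : surj res_aug
}.

Definition FP_infty M : Prop :=
  exists P : resolution M, forall n, projective (P n) /\ fin_generated (P n).

(* Ext^1_R(M, N) = 0, with Ext^1 computed as H^1 (Hom_R (P, N)) for projective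
   resolutions P of M: every 1-cocycle is a 1-coboundary. *)
Definition Ext1_zero M N : Prop :=
  forall P : resolution M, (forall n, projective (P n)) ->
    forall f : {linear P 1 -> N}, (forall x, f (res_d P 1 x) = 0) ->
      exists g : {linear P 0 -> N}, forall x, f x = g (res_d P 0 x).

Definition abs_clean (A : lmodType R) : Prop :=
  forall F : lmodType R, FP_infty F -> Ext1_zero F A.

End Modules.

Section Tensor.
Variables (R : pzRingType) (A : lmodType R^c) (M : lmodType R).

Local Notation FG := {freeg (A * M)%type}.

(* A (x)_R M is the free abelian group on A * M modulo this subgroup. *)
Inductive tensor_rel : FG -> Prop :=
| trel0 : tensor_rel 0
| trelB x y : tensor_rel x -> tensor_rel y -> tensor_rel (x - y)
| trelDl a a' m : tensor_rel (<< (a + a', m) >> - << (a, m) >> - << (a', m) >>)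
| trelDr a m m' : tensor_rel (<< (a, m + m') >> - << (a, m) >> - << (a, m') >>)
| trelZ (r : R) a m :
    tensor_rel (<< ((r : R^c) *: a, m) >> - << (a, r *: m) >>).

Definition tensor_relb (x : FG) : bool := `[< tensor_rel x >].

Fact tensor_relb_zmod_closed : zmod_closed tensor_relb.
Proof.
split=> [|x y]; first exact/asboolP/trel0.
by move=> /asboolP hx /asboolP hy; apply/asboolP/trelB.
Qed.

HB.instance Definition _ :=
  GRing.isZmodClosed.Build FG tensor_relb tensor_relb_zmod_closed.

Definition tensor_sub : zmodClosed FG := GRing.ZmodClosed.clone _ tensor_relb _.

Definition tensor : Type := {ideal_quot tensor_sub}.

HB.instance Definition _ := GRing.Zmodule.on tensor.

Definition tens (a : A) (m : M) : tensor :=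
  \pi_({ideal_quot tensor_sub}) << (a, m) >>.

Definition balanced (G : zmodType) (b : A -> M -> G) : Prop :=
  [/\ forall a a' m, b (a + a') m = b a m + b a' m,
      forall a m m', b a (m + m') = b a m + b a m' &
      forall (r : R) a m, b ((r : R^c) *: a) m = b a (r *: m)].

(* The additive map induced by b; meaningful only when b is balanced. *)
Definition tensor_lift (G : zmodType) (b : A -> M -> G) (x : tensor) : G :=
  fglift (fun p : A * M => b p.1 p.2 : zmodule G)
    (repr (x : {ideal_quot tensor_sub})).

End Tensor.

Section TensorTheory.
Variables (R : pzRingType) (A : lmodType R^c) (M : lmodType R).

Lemma tens_balanced : balanced (@tens R A M).
Proof.
split=> [a a' m|a m m'|r a m]; rewrite /tens.
- rewrite -raddfD; apply/eqP; rewrite -Quotient.idealrBE opprD addrA.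
  exact/asboolP/trelDl.
- rewrite -raddfD; apply/eqP; rewrite -Quotient.idealrBE opprD addrA.
  exact/asboolP/trelDr.
- apply/eqP; rewrite -Quotient.idealrBE; exact/asboolP/trelZ.
Qed.

Section Lift.
Variables (G : zmodType) (b : A -> M -> G).
Hypothesis bb : balanced b.

Let l := fglift (fun p : A * M => b p.1 p.2 : zmodule G).

Let lB x y : l (x - y) = l x - l y.
Proof. exact: lift_is_additive. Qed.

Let lU p : l << p >> = b p.1 p.2.
Proof. by rewrite /l liftU scale1r. Qed.

Let l_rel x : tensor_rel x -> l x = 0.
Proof.
case: bb => bDl bDr bZ; elim=> [|y z _ hy _ hz|a a' m|a m m'|r a m].
- by rewrite -[X in l X](subrr 0) lB subrr.
- by rewrite lB hy hz subr0.
- by rewrite !lB !lU /= bDl addrAC addrK subrr.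
- by rewrite !lB !lU /= bDr addrAC addrK subrr.
- by rewrite !lB !lU /= bZ subrr.
Qed.

Let lift_pi x : tensor_lift b (\pi_({ideal_quot (tensor_sub A M)}) x) = l x.
Proof.
rewrite /tensor_lift -/l; set y := repr _; apply/eqP; rewrite -subr_eq0 -lB.
apply/eqP/l_rel/asboolP; have: y - x \in tensor_sub A M; last by [].
by rewrite Quotient.idealrBE reprK.
Qed.

Lemma tensor_liftE a m : tensor_lift b (tens a m) = b a m.
Proof. by rewrite lift_pi lU. Qed.

Lemma tensor_lift_is_zmod_morphism : zmod_morphism (tensor_lift b).
Proof.
move=> x y; rewrite -[x](@reprK _ {ideal_quot (tensor_sub A M)}).
rewrite -[y](@reprK _ {ideal_quot (tensor_sub A M)}).
by rewrite -raddfB !lift_pi lB.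
Qed.

End Lift.

Lemma tensor_ind (P : tensor A M -> Prop) :
  P 0 -> (forall a m x, P x -> P (tens a m + x)) -> forall x, P x.
Proof.
move=> P0 PD.
have tN (a : A) (m : M) : - tens a m = tens (- a) m.
  have [bDl _ _] := tens_balanced; apply/eqP.
  have t0 : tens (0 : A) m = 0.
    by rewrite -[LHS](addrK (tens 0 m)) -bDl addr0 subrr.
  by rewrite eq_sym -addr_eq0 -bDl addNr t0.
have PU (k : int) a m x : P x -> P (tens a m *~ k + x).
  move=> Px; case: k => n; last rewrite NegzE mulrNz -mulNrz tN.
    by elim: n => [|n IH]; rewrite ?mulr0z ?add0r // intS mulrzDr -addrA; apply: PD.
  by elim: n.+1 => [|{}n IH]; rewrite ?mulr0z ?add0r // intS mulrzDr -addrA; apply: PD.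
move=> x; rewrite -[x](@reprK _ {ideal_quot (tensor_sub A M)}).
elim/freeg_ind_dom0: (repr _) => [|k [a m] D _ _ IH]; first by rewrite raddf0.
rewrite raddfD -[k]intz -freegU_mulz raddfMz; exact: PU.
Qed.

End TensorTheory.

Section TensorMap.
Variables (R : pzRingType) (A B : lmodType R^c) (M N : lmodType R).
Variables (g : {linear A -> B}) (f : {linear M -> N}).

Definition tensor_map : tensor A M -> tensor B N :=
  tensor_lift (fun a m => tens (g a) (f m)).

Fact tensor_map_balanced : balanced (fun a m => tens (g a) (f m)).
Proof.
have [bDl bDr bZ] := @tens_balanced R B N.
by split=> [a a' m|a m m'|r a m]; rewrite ?linearD ?bDl ?bDr // !linearZ /= bZ.
Qed.

Lemma tensor_mapE a m : tensor_map (tens a m) = tens (g a) (f m).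
Proof. exact: (tensor_liftE tensor_map_balanced). Qed.

HB.instance Definition _ := GRing.isZmodMorphism.Build _ _ tensor_map
  (tensor_lift_is_zmod_morphism tensor_map_balanced).

End TensorMap.

Section GorensteinACFlat.
Variable R : pzRingType.

(* The functor (- (x)_R M) is exact. *)
Definition flat (M : lmodType R) : Prop :=
  forall (A B C : lmodType R^c) (f : {linear A -> B}) (g : {linear B -> C}),
    exact f g ->
    exact (tensor_map f (idfun : {linear M -> M}))
          (tensor_map g (idfun : {linear M -> M})).

(* ... -> F (i + 1) -> F i -> ... ; the exactness conditions below range over
   all i : int, and so cover every spot of the sequence. *)
Record int_sequence := IntSequence {
  seq_obj :> int -> lmodType R;
  seq_d : forall i, {linear seq_obj (i + 1) -> seq_obj i}
}.

Definition exact_complex (F : int_sequence) : Prop :=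
  forall i, exact (seq_d F (i + 1)) (seq_d F i).

Definition tensor_exact (A : lmodType R^c) (F : int_sequence) : Prop :=
  forall i, exact (tensor_map (idfun : {linear A -> A}) (seq_d F (i + 1)))
                  (tensor_map (idfun : {linear A -> A}) (seq_d F i)).

(* M is isomorphic to the kernel of some differential of F. *)
Definition is_cycle (F : int_sequence) (M : lmodType R) : Prop :=
  exists i (j : {linear M -> F (i + 1)}), injective j /\ exact j (seq_d F i).

Definition GF_ac (M : lmodType R) : Prop :=
  exists F : int_sequence,
    [/\ forall i, flat (F i),
        exact_complex F,
        forall A : lmodType R^c, abs_clean A -> tensor_exact A F &
        is_cycle F M].

End GorensteinACFlat.

Section Covers.
Variables (R : pzRingType) (X : lmodType R -> Prop).

Definition closed_under_extensions : Prop :=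
  forall (M' M M'' : lmodType R) (f : {linear M' -> M}) (g : {linear M -> M''}),
    injective f -> exact f g -> surj g -> X M' -> X M'' -> X M.

Definition precover (M C : lmodType R) (phi : {linear C -> M}) : Prop :=
  X C /\
  forall (C' : lmodType R) (psi : {linear C' -> M}), X C' ->
    exists h : {linear C' -> C}, forall x, phi (h x) = psi x.

Definition cover (M C : lmodType R) (phi : {linear C -> M}) : Prop :=
  precover phi /\
  forall f : {linear C -> C}, (forall x, phi (f x) = phi x) -> bijective f.

Definition covering : Prop :=
  forall M : lmodType R,
    exists (C : lmodType R) (phi : {linear C -> M}), cover phi.

End Covers.

(* Main.v *)
Require Import Defs.
From Stdlib Require List.
From HB Require Import structures.
From mathcomp Require Import all_boot all_algebra.
From mathcomp Require Import boolp classical_sets.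
From mathcomp Require Import freeg.

(** Gorenstein AC-flat modules are not visibly stable under direct limits, but the
complexes that define them are.  Call a complex X of flat modules acyclic here if
A (x) X is exact for every absolutely clean A and for A = R.  Over any ring, the
class of these complexes ([acflat]) is closed under direct sums, under retracts,
under colimits of chains of quotients ([acflat_chain]) and under quotients by
pure acyclic subcomplexes ([acflat_pure]), and the Gorenstein AC-flat modules are
the cokernels of the differentials of its members ([GF_coker0], [coker_GF]).  A
linear map from the cokernel of X 1 -> X 0 to M is a map psi : X 0 -> M that
vanishes on boundaries; a pair (X, psi) is called a complex over M.

Some complex C over M receives a map from each of the others
([weak_terminal]).  Dividing X by a maximal subcomplex of ker psi with quotient
in the class, it may be assumed that ker psi contains no pure acyclic subcomplex
other than 0.  The size of X is then bounded in terms of R and M alone: one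
closes up a small subcomplex D so that each small subcomplex S of X has a
retraction sigma : S -> D over M fixing the intersection of S and D.  If D were
proper, a small pure acyclic subcomplex J of X / D would lift to some S, and the
elements s - sigma s would form a copy of J, pure in X and killed by psi
([small_of_minimal]).  Instead of a cardinal, the bound is an explicit inductive
type of formal elements, [wterm], and C is the direct sum of all the complexes
over M that it bounds.

Since the class is closed under colimits of chains, the argument of Enochs turns C
into a complex all of whose endomorphisms over M are bijective
([weakly_terminal_inj], [endo_surj], [cover_exists]).  Transfinite chains are
replaced by Zorn's lemma for quotients of one direct sum of copies of C, in which
copies are progressively identified.

It remains to descend from the complex C to the module Z, its cokernel in
degree 0, and this is where closure under extensions enters.  The map Z -> M is
a precover because every Gorenstein AC-flat module is such a cokernel.  If f is
an endomorphism of Z over M, then [extend_map] prolongs the composite of f with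
C 0 -> Z to a chain map C -> Y into a complex of the class whose cokernel in
degree 0 is Z; each step to the left or right builds a pullback or a pushout,
which is again Gorenstein AC-flat as an extension of two such modules.  Composing
with a map Y -> C over M gives an endomorphism of C over M, which is bijective;
so f has a left inverse over M.  That left inverse has one as well, and f is
bijective. *)

Set Implicit Arguments.
Unset Strict Implicit.
Unset Printing Implicit Defensive.

Import GRing.Theory.
Local Open Scope ring_scope.
Local Open Scope quotient_scope.

Lemma dep_choice (I : Type) (Y : I -> Type) (P : forall i, Y i -> Prop) :
  (forall i, exists y, P i y) -> exists f : forall i, Y i, forall i, P i (f i).
Proof.
move=> h; exists (fun i => projT1 (cid (h i))) => i; exact: (projT2 (cid (h i))).
Qed.

(** * Linear maps, submodules, quotients and direct sums *)

Section MkLin.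
Variables (R : pzRingType) (U V : lmodType R) (f : U -> V).
Definition mklin_fun (_ : linear f) : U -> V := f.
Variable h : linear f.
HB.instance Definition _ := GRing.isLinear.Build R U V _ (mklin_fun h) h.
(** The proof is opaque, so that simplification does not unfold the maps built with
[mklin]. *)
Fact mklin_key : {L : {linear U -> V} | forall x, L x = f x}.
Proof. by exists (mklin_fun h). Qed.
Definition mklin : {linear U -> V} := proj1_sig mklin_key.
Lemma mklinE x : mklin x = f x. Proof. exact: (proj2_sig mklin_key). Qed.
End MkLin.

Record submod (R : pzRingType) (M : lmodType R) := Submod {
  smem :> M -> Prop;
  smem0 : smem 0;
  smem_lin : forall (a : R) x y, smem x -> smem y -> smem (a *: x + y)
}.

Section Sub.
Variables (R : pzRingType) (M : lmodType R) (K : submod M).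

Lemma smemZ a x : K x -> K (a *: x).
Proof. by move=> hx; rewrite -[_ *: _]addr0; apply: smem_lin => //; apply: smem0. Qed.
Lemma smemN x : K x -> K (- x).
Proof. by move=> hx; rewrite -scaleN1r; apply: smemZ. Qed.
Definition smemb : pred M := fun x => `[< K x >].

Fact smemb_closed : submod_closed smemb.
Proof.
split=> [|a x y /asboolP hx /asboolP hy]; apply/asboolP; first exact: smem0.
exact: smem_lin.
Qed.

HB.instance Definition _ := GRing.isSubmodClosed.Build R M smemb smemb_closed.

Record subm_type : Type := Subm { subm_val : M; subm_valP : smemb subm_val }.

HB.instance Definition _ := [isSub for subm_val].
HB.instance Definition _ := [Choice of subm_type by <:].
HB.instance Definition _ := [SubChoice_isSubLmodule of subm_type by <:].

Definition subm : lmodType R := subm_type.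

Definition sincl : {linear subm -> M} := mklin (fun a x y => linearP (val : {linear subm -> M}) a x y).

Lemma sincl_inj : injective sincl. Proof. by move=> x y; rewrite !mklinE => /val_inj. Qed.
Lemma sinclP x : K (sincl x). Proof. by rewrite mklinE; apply/asboolP/subm_valP. Qed.
Lemma sincl_ex x : K x -> exists y, sincl y = x.
Proof. by move=> /asboolP h; exists (Subm h); rewrite mklinE. Qed.
End Sub.

Section Quot.
Variables (R : pzRingType) (M : lmodType R) (K : submod M).

Definition quot_sub : zmodClosed M := GRing.ZmodClosed.clone _ (smemb K) _.
Definition quot_type : Type := {ideal_quot quot_sub}.
HB.instance Definition _ := GRing.Zmodule.on quot_type.

Definition qpi_fun (x : M) : quot_type := \pi_({ideal_quot quot_sub}) x.

Lemma qpi_funP x y : qpi_fun x = qpi_fun y <-> K (x - y).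
Proof.
split=> [/eqP|h].
  by rewrite -Quotient.idealrBE => /asboolP.
by apply/eqP; rewrite -Quotient.idealrBE; apply/asboolP.
Qed.

Lemma qpi_fun_surj (q : quot_type) : exists x, qpi_fun x = q.
Proof. by exists (repr (q : {ideal_quot quot_sub})); apply: reprK. Qed.

Lemma qpi_fun_is_add : zmod_morphism qpi_fun.
Proof. by move=> x y; rewrite /qpi_fun raddfB. Qed.
HB.instance Definition _ := GRing.isZmodMorphism.Build M quot_type qpi_fun qpi_fun_is_add.

Definition qscale (a : R) (q : quot_type) : quot_type :=
  qpi_fun (a *: repr (q : {ideal_quot quot_sub})).

Lemma qscaleE a x : qscale a (qpi_fun x) = qpi_fun (a *: x).
Proof.
rewrite /qscale; apply/qpi_funP; rewrite -scalerBr; apply: smemZ.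
apply/qpi_funP; exact: reprK.
Qed.

Fact qscaleA a b q : qscale a (qscale b q) = qscale (a * b) q.
Proof. by have [x <-] := qpi_fun_surj q; rewrite !qscaleE scalerA. Qed.
Fact qscale1 : left_id 1 qscale.
Proof. by move=> q; have [x <-] := qpi_fun_surj q; rewrite !qscaleE scale1r. Qed.
Fact qscaleDr : right_distributive qscale +%R.
Proof.
move=> a q q'; have [x <-] := qpi_fun_surj q; have [y <-] := qpi_fun_surj q'.
by rewrite -raddfD !qscaleE scalerDr raddfD.
Qed.
Fact qscaleDl q : {morph qscale^~ q : a b / a + b}.
Proof.
by move=> a b; have [x <-] := qpi_fun_surj q; rewrite !qscaleE scalerDl raddfD.
Qed.
HB.instance Definition _ :=
  GRing.Zmodule_isLmodule.Build R quot_type qscaleA qscale1 qscaleDr qscaleDl.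

Definition quot : lmodType R := quot_type.

Fact qpi_linear : linear qpi_fun.
Proof. move=> a x y; rewrite (raddfD (qpi_fun : {additive M -> quot})) /=.
by rewrite -[X in _ = X + _]/(qscale a (qpi_fun x)) qscaleE. Qed.
Definition qpi : {linear M -> quot} := mklin qpi_linear.

Lemma qpiP x y : qpi x = qpi y <-> K (x - y).
Proof. by rewrite !mklinE; apply: qpi_funP. Qed.
Lemma qpi_surj : surj qpi. Proof. by move=> q; have [x <-] := qpi_fun_surj q; exists x; rewrite mklinE. Qed.
Lemma qpi0P x : qpi x = 0 <-> K x.
Proof. by rewrite -(linear0 qpi) qpiP subr0. Qed.

Lemma qpi0 x : K x -> qpi x = 0. Proof. by move/qpi0P. Qed.
End Quot.

Section LinFactor.
Variables (R : pzRingType).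

Lemma surj_factor (M N P : lmodType R) (g : {linear M -> N}) (f : {linear M -> P}) :
  surj g -> (forall x, g x = 0 -> f x = 0) ->
  exists h : {linear N -> P}, forall x, h (g x) = f x.
Proof.
move=> sg hf.
have [s hs] := choice sg.
have wd x x' : g x = g x' -> f x = f x'.
  move=> e; apply/eqP; rewrite -subr_eq0 -linearB; apply/eqP/hf.
  by rewrite linearB e subrr.
have l : linear (fun y => f (s y)).
  by move=> a x y; rewrite -linearP; apply: wd; rewrite linearP !hs.
by exists (mklin l) => x; rewrite mklinE; apply: wd; rewrite hs.
Qed.

Lemma inj_factor (M N P : lmodType R) (i : {linear N -> M}) (f : {linear P -> M}) :
  injective i -> (forall x, exists y, i y = f x) ->
  exists h : {linear P -> N}, forall x, i (h x) = f x.
Proof.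
move=> ii /choice [s hs].
have l : linear s by move=> a x y; apply: ii; rewrite hs !linearP !hs.
by exists (mklin l) => x; rewrite mklinE.
Qed.

Lemma inj0P (U V : zmodType) (f : {additive U -> V}) :
  (forall x, f x = 0 -> x = 0) -> injective f.
Proof.
by move=> h x y e; apply/eqP; rewrite -subr_eq0; apply/eqP/h; rewrite raddfB e subrr.
Qed.

Lemma linj (U V : lmodType R) (f : {linear U -> V}) :
  (forall x, f x = 0 -> x = 0) -> injective f.
Proof. exact: inj0P. Qed.

Fact ker_lin (M N : lmodType R) (f : {linear M -> N}) (a : R) x y :
  f x = 0 -> f y = 0 -> f (a *: x + y) = 0.
Proof. by move=> hx hy; rewrite linearP hx hy scaler0 addr0. Qed.
Definition kerm (M N : lmodType R) (f : {linear M -> N}) : submod M :=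
  Submod (linear0 f) (@ker_lin M N f).

Fact img0 (M N : lmodType R) (f : {linear M -> N}) : exists x, f x = 0.
Proof. by exists 0; rewrite linear0. Qed.
Fact img_lin (M N : lmodType R) (f : {linear M -> N}) (a : R) y z :
  (exists x, f x = y) -> (exists x, f x = z) -> exists x, f x = a *: y + z.
Proof. by move=> [x <-] [x' <-]; exists (a *: x + x'); rewrite linearP. Qed.
Definition imgm (M N : lmodType R) (f : {linear M -> N}) : submod N :=
  Submod (img0 f) (@img_lin M N f).
End LinFactor.

Section DSum.
Variables (R : pzRingType) (I : choiceType) (X : I -> lmodType R).

Record dsum_type := DSum {
  dfun :> forall k, X k;
  dfin : exists s : seq I, forall k, k \notin s -> dfun k = 0
}.

Lemma dsum_eq (f g : dsum_type) : (forall k, f k = g k) -> f = g.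
Proof.
case: f g => [f hf] [g hg] /= h.
have e : f = g by apply: functional_extensionality_dep.
by subst g; congr DSum; apply: Prop_irrelevance.
Qed.

HB.instance Definition _ := gen_eqMixin dsum_type.
HB.instance Definition _ := gen_choiceMixin dsum_type.

Program Definition dsum0 := @DSum (fun k => 0) _.
Next Obligation. by exists [::]. Qed.
Program Definition dsumN (f : dsum_type) := @DSum (fun k => - f k) _.
Next Obligation. by have [s h] := dfin f; exists s => k /h ->; rewrite oppr0. Qed.
Program Definition dsumD (f g : dsum_type) := @DSum (fun k => f k + g k) _.
Next Obligation.
have [s h] := dfin f; have [s' h'] := dfin g; exists (s ++ s') => k.
by rewrite mem_cat negb_or => /andP [/h -> /h' ->]; rewrite addr0.
Qed.
Program Definition dsumZ a (f : dsum_type) := @DSum (fun k => a *: f k) _.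
Next Obligation. by have [s h] := dfin f; exists s => k /h ->; rewrite scaler0. Qed.

Fact dsumDA : associative dsumD. Proof. by move=> f g h; apply: dsum_eq => k; apply: addrA. Qed.
Fact dsumDC : commutative dsumD. Proof. by move=> f g; apply: dsum_eq => k; apply: addrC. Qed.
Fact dsumD0 : left_id dsum0 dsumD. Proof. by move=> f; apply: dsum_eq => k; apply: add0r. Qed.
Fact dsumDN : left_inverse dsum0 dsumN dsumD. Proof. by move=> f; apply: dsum_eq => k; apply: addNr. Qed.
HB.instance Definition _ := GRing.isZmodule.Build dsum_type dsumDA dsumDC dsumD0 dsumDN.
Fact dsumZA a b f : dsumZ a (dsumZ b f) = dsumZ (a * b) f.
Proof. by apply: dsum_eq => k; apply: scalerA. Qed.
Fact dsumZ1 : left_id 1 dsumZ. Proof. by move=> f; apply: dsum_eq => k; apply: scale1r. Qed.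
Fact dsumZD : right_distributive dsumZ +%R.
Proof. by move=> a f g; apply: dsum_eq => k; apply: scalerDr. Qed.
Fact dsumDZ f : {morph dsumZ^~ f : a b / a + b}.
Proof. by move=> a b; apply: dsum_eq => k; apply: scalerDl. Qed.
HB.instance Definition _ := GRing.Zmodule_isLmodule.Build R dsum_type dsumZA dsumZ1 dsumZD dsumDZ.

Definition dsum : lmodType R := dsum_type.

Lemma dproj_linear k : linear (fun f : dsum => f k). Proof. by []. Qed.
Definition dproj k : {linear dsum -> X k} := mklin (@dproj_linear k).
Lemma dprojE k f : dproj k f = f k. Proof. exact: mklinE. Qed.

Definition dinj_fun k (x : X k) : forall j, X j :=
  fun j => if @eqP _ k j is ReflectT e then eq_rect k X x j e else 0.
Lemma dinj_funE k (x : X k) : dinj_fun x k = x.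
Proof. by rewrite /dinj_fun; case: eqP => // e; rewrite (eq_irrelevance e erefl). Qed.
Lemma dinj_fun0 k j (x : X k) : k != j -> dinj_fun x j = 0.
Proof. by rewrite /dinj_fun; case: eqP. Qed.
Program Definition dinjd k (x : X k) := @DSum (dinj_fun x) _.
Next Obligation.
by exists [:: k] => j; rewrite inE eq_sym => /dinj_fun0.
Qed.
Lemma dinj_linear k : linear (@dinjd k).
Proof.
move=> a x y; apply: dsum_eq => j.
have -> : (a *: dinjd x + dinjd y : dsum) j = a *: (dinj_fun x j) + dinj_fun y j by [].
rewrite /= /dinj_fun; case: eqP => [e|_]; first by destruct e.
by rewrite scaler0 addr0.
Qed.
Definition dinj k : {linear X k -> dsum} := mklin (@dinj_linear k).
Lemma dinjE k x : dinj k x k = x. Proof. by rewrite mklinE; apply: dinj_funE. Qed.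
Lemma dinj0 k j x : k != j -> dinj k x j = 0. Proof. by rewrite mklinE => h; apply: (dinj_fun0 x h). Qed.

Lemma dsum_sumE (J : Type) (s : seq J) (F : J -> dsum) k :
  (\sum_(i <- s) F i) k = \sum_(i <- s) F i k.
Proof.
by rewrite -dprojE linear_sum; apply: eq_bigr => i _; apply: dprojE.
Qed.

Lemma dsum_decomp (f : dsum) (s : seq I) :
  uniq s -> (forall k, k \notin s -> f k = 0) -> f = \sum_(k <- s) dinj k (f k).
Proof.
move=> us hs; apply: dsum_eq => k; rewrite dsum_sumE.
have [ks|ks] := boolP (k \in s).
  rewrite (bigD1_seq k) //= dinjE big1 ?addr0 // => j jk.
  by rewrite dinj0.
rewrite hs // big_seq big1 // => j js; rewrite dinj0 //.
by apply: contraNneq ks => <-.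
Qed.

Lemma dsum_supp (f : dsum) : exists s, uniq s /\ forall k, k \notin s -> f k = 0.
Proof.
have [s h] := dfin f; exists (undup s); split; first exact: undup_uniq.
by move=> k; rewrite mem_undup; apply: h.
Qed.

Lemma dsum_ind (P : dsum -> Prop) :
  P 0 -> (forall k x f, P f -> P (dinj k x + f)) -> forall f, P f.
Proof.
move=> P0 PD f; have [s [us hs]] := dsum_supp f.
rewrite (dsum_decomp us hs) {us hs}; elim: s => [|k s IH]; first by rewrite big_nil.
by rewrite big_cons; apply: PD.
Qed.

(** The sum of the h k (f k) over a finite support of f does not depend on the
chosen support, which gives linearity. *)
Lemma dsum_lift (N : lmodType R) (h : forall k, {linear X k -> N}) :
  exists g : {linear dsum -> N}, forall k x, g (dinj k x) = h k x.
Proof.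
have [s hs] := choice dsum_supp.
pose g (f : dsum) := \sum_(k <- s f) h k (f k).
have gE (f : dsum) t : uniq t -> (forall k, k \notin t -> f k = 0) ->
    g f = \sum_(k <- t) h k (f k).
  move=> ut ht; have [us hs'] := hs f.
  have E u : uniq u -> (forall k, k \notin u -> f k = 0) ->
     \sum_(k <- u) h k (f k) = \sum_(k <- undup (s f ++ t) | k \in u) h k (f k).
    move=> uu hu; set v := undup (s f ++ t).
    rewrite -[RHS]big_filter.
    rewrite (bigID (mem v)) /= [X in _ + X]big1 ?addr0; last first.
      move=> k; rewrite mem_undup mem_cat negb_or => /andP [/hs' -> _].
      by rewrite linear0.
    rewrite -big_filter; apply: perm_big; apply: uniq_perm; rewrite ?filter_uniq ?undup_uniq //.
    by move=> k; rewrite !mem_filter andbC.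
  rewrite /g E // [RHS]E // big_mkcond [RHS]big_mkcond; apply: eq_bigr => k _.
  have [/negbTE ks|ks] := boolP (k \notin s f).
    by rewrite ks hs' ?ks ?linear0 ?if_same.
  rewrite negbK in ks; rewrite ks; case: ifP => // /negbT kt.
  by rewrite ht ?linear0.
have lg : linear g.
  move=> a x y.
  have [sx hx] := hs x; have [sy hy] := hs y.
  pose t := undup (s x ++ s y).
  have hxt k : k \notin t -> x k = 0.
    by rewrite mem_undup mem_cat negb_or => /andP [/hx].
  have hyt k : k \notin t -> y k = 0.
    by rewrite mem_undup mem_cat negb_or => /andP [_ /hy].
  have ut : uniq t by exact: undup_uniq.
  have E k : (a *: x + y) k = a *: x k + y k by [].
  rewrite (gE x t) // (gE y t) // (gE _ t) //; last first.
    by move=> k kt; rewrite E hxt // hyt // scaler0 addr0.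
  rewrite scaler_sumr -big_split /=; apply: eq_bigr => k _.
  by rewrite linearP.
exists (mklin lg) => k x; rewrite mklinE (gE _ [:: k]) //.
  by rewrite big_seq1 dinjE.
by move=> j; rewrite inE eq_sym => /dinj0 ->.
Qed.
End DSum.
Arguments dinj {R I X} k.
Arguments dproj {R I X} k.

(** * Tensor products *)

Notation idl M := (idfun : {linear M -> M}).

Section TensBasics.
Variables (R : pzRingType) (A : lmodType R^c) (M : lmodType R).
Implicit Types (a : A) (m : M).

Lemma tensDl a a' m : tens (a + a') m = tens a m + tens a' m.
Proof. by have [h _ _] := @tens_balanced R A M. Qed.
Lemma tensDr a m m' : tens a (m + m') = tens a m + tens a m'.
Proof. by have [_ h _] := @tens_balanced R A M. Qed.
Lemma tensZ (r : R) a m : tens ((r : R^c) *: a) m = tens a (r *: m).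
Proof. by have [_ _ h] := @tens_balanced R A M. Qed.
Lemma tens0l m : tens (0 : A) m = 0.
Proof. by apply: (addrI (tens 0 m)); rewrite -tensDl !addr0. Qed.
Lemma tens0r a : tens a (0 : M) = 0.
Proof. by apply: (addrI (tens a 0)); rewrite -tensDr !addr0. Qed.
Lemma tensNl a m : tens (- a) m = - tens a m.
Proof. by apply/eqP; rewrite -addr_eq0 -tensDl addNr tens0l. Qed.
Lemma tensNr a m : tens a (- m) = - tens a m.
Proof. by apply/eqP; rewrite -addr_eq0 -tensDr addNr tens0r. Qed.

Lemma tens_list (t : tensor A M) :
  exists L : seq (A * M), t = \sum_(p <- L) tens p.1 p.2.
Proof.
elim/tensor_ind: t => [|a m x [L ->]]; first by exists [::]; rewrite big_nil.
by exists ((a, m) :: L); rewrite big_cons.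
Qed.

End TensBasics.

Section TMap.
Variable R : pzRingType.

Lemma tmap_sum (A B : lmodType R^c) (M N : lmodType R) (g : {linear A -> B})
  (f : {linear M -> N}) (I : Type) (s : seq I) (F : I -> A) (G : I -> M) :
  tensor_map g f (\sum_(i <- s) tens (F i) (G i)) = \sum_(i <- s) tens (g (F i)) (f (G i)).
Proof. by rewrite raddf_sum; apply: eq_bigr => p _; apply: tensor_mapE. Qed.

Section TmapAdd.
Variables (A B : lmodType R^c) (M N : lmodType R) (g : {linear A -> B}) (f : {linear M -> N}).
Lemma tmap0 : tensor_map g f 0 = 0. Proof. exact: raddf0. Qed.
Lemma tmapD x y : tensor_map g f (x + y) = tensor_map g f x + tensor_map g f y.
Proof. exact: raddfD. Qed.
Lemma tmapB x y : tensor_map g f (x - y) = tensor_map g f x - tensor_map g f y.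
Proof. exact: raddfB. Qed.
Lemma tmap_bigsum (I : Type) (s : seq I) (F : I -> tensor A M) :
  tensor_map g f (\sum_(i <- s) F i) = \sum_(i <- s) tensor_map g f (F i).
Proof. exact: raddf_sum. Qed.
End TmapAdd.

Lemma tmap_comp (A B C : lmodType R^c) (M N P : lmodType R)
  (g : {linear A -> B}) (f : {linear M -> N})
  (g' : {linear B -> C}) (f' : {linear N -> P})
  (h : {linear A -> C}) (k : {linear M -> P}) :
  (forall a, g' (g a) = h a) -> (forall m, f' (f m) = k m) ->
  forall t, tensor_map g' f' (tensor_map g f t) = tensor_map h k t.
Proof.
move=> hg hf t; have [L ->] := tens_list t; rewrite !tmap_sum.
by apply: eq_bigr => p _; rewrite hg hf.
Qed.

Lemma tmap_id (A : lmodType R^c) (M : lmodType R) (g : {linear A -> A}) (f : {linear M -> M}) :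
  (forall a, g a = a) -> (forall m, f m = m) -> forall t, tensor_map g f t = t.
Proof.
move=> hg hf t; have [L ->] := tens_list t; rewrite !tmap_sum.
by apply: eq_bigr => p _; rewrite hg hf.
Qed.

Lemma tmap_comm (A B B' C : lmodType R^c) (M N N' P : lmodType R)
  (g : {linear A -> B}) (f : {linear M -> N})
  (g' : {linear B -> C}) (f' : {linear N -> P})
  (h : {linear A -> B'}) (k : {linear M -> N'})
  (h' : {linear B' -> C}) (k' : {linear N' -> P}) :
  (forall a, g' (g a) = h' (h a)) -> (forall m, f' (f m) = k' (k m)) ->
  forall t, tensor_map g' f' (tensor_map g f t) = tensor_map h' k' (tensor_map h k t).
Proof.
move=> hg hf t; have [L ->] := tens_list t; rewrite !tmap_sum.
by apply: eq_bigr => p _; rewrite hg hf.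
Qed.

Lemma tmap_0 (A B : lmodType R^c) (M N : lmodType R)
  (g : {linear A -> B}) (f : {linear M -> N}) :
  (forall m, f m = 0) -> forall t, tensor_map g f t = 0.
Proof.
move=> h t; have [L ->] := tens_list t; rewrite !tmap_sum big1 // => p _.
by rewrite h tens0r.
Qed.
End TMap.

Section Relations.
Variables (R : pzRingType) (A : lmodType R^c) (M : lmodType R).

Inductive rel_inst :=
| RDl (a a' : A) (m : M)
| RDr (a : A) (m m' : M)
| RZ (r : R) (a : A) (m : M).

Definition sat (G : zmodType) (H : G -> Prop) (b : A -> M -> G) (c : rel_inst) : Prop :=
  match c with
  | RDl a a' m => H (b (a + a') m - b a m - b a' m)
  | RDr a m m' => H (b a (m + m') - b a m - b a m')
  | RZ r a m => H (b ((r : R^c) *: a) m - b a (r *: m))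
  end.

Definition subgroup (G : zmodType) (H : G -> Prop) : Prop :=
  H 0 /\ forall x y, H x -> H y -> H (x - y).

(** A vanishing sum in A (x) M is a consequence of finitely many of the defining
relations.  Hence every map b that respects these finitely many relations modulo
a subgroup H sends the sum into H.  Right exactness, and the transfer of vanishing
to subcomplexes, are both obtained by a good choice of b. *)
Lemma tensor_zero_witness (L : seq (A * M)) :
  \sum_(p <- L) tens p.1 p.2 = 0 ->
  exists C : seq rel_inst, forall (G : zmodType) (H : G -> Prop) (b : A -> M -> G),
    subgroup H -> List.Forall (sat H b) C -> H (\sum_(p <- L) b p.1 p.2).
Proof.
move=> h.
pose D : {freeg (A * M)%type} := \sum_(p <- L) << p >>.
have hD : tensor_rel D.
  have /eqP : \pi_({ideal_quot (tensor_sub A M)}) D = \pi 0.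
    rewrite raddf0; apply: etrans h; rewrite /D.
    elim: L {D} => [|[a m] L IH]; first by rewrite !big_nil raddf0.
    by rewrite !big_cons raddfD; congr (_ + _); apply: IH.
  by rewrite -Quotient.idealrBE subr0 => /asboolP.
pose lft (G : zmodType) (b : A -> M -> G) := fglift (fun p : A * M => b p.1 p.2 : zmodule G).
have lB G b x y : lft G b (x - y) = lft G b x - lft G b y.
  exact: lift_is_additive.
have lU G b p : lft G b << p >> = b p.1 p.2 by rewrite /lft liftU scale1r.
have {hD} [C hC] : exists C : seq rel_inst, forall (G : zmodType) (H : G -> Prop) b,
    subgroup H -> List.Forall (sat H b) C -> H (lft G b D).
  elim: hD => {h} [|x y _ [C hC] _ [C' hC']|a a' m|a m m'|r a m].
  - exists [::] => G H b [H0 _] _; by rewrite -[X in lft _ _ X](subrr 0) lB subrr.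
  - exists (C ++ C') => G H b sH /List.Forall_app [h1 h2]; rewrite lB.
    by apply: sH.2; [apply: hC|apply: hC'].
  - exists [:: RDl a a' m] => G H b _ h; rewrite !lB !lU; exact: (List.Forall_inv h).
  - exists [:: RDr a m m'] => G H b _ h; rewrite !lB !lU; exact: (List.Forall_inv h).
  - exists [:: RZ r a m] => G H b _ h; rewrite !lB !lU; exact: (List.Forall_inv h).
exists C => G H b sH hb; have := hC G H b sH hb; rewrite /D.
suff -> : lft G b (\sum_(p <- L) << p >>) = \sum_(p <- L) b p.1 p.2 by [].
have l0 : lft G b 0 = 0 by rewrite -[X in lft _ _ X](subrr 0) lB subrr.
have lD x y : lft G b (x + y) = lft G b x + lft G b y.
  by rewrite -{1}[y]opprK lB -[- y]add0r lB l0 sub0r opprK.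
elim: L {h D hC} => [|p L IH]; first by rewrite !big_nil l0.
by rewrite !big_cons lD lU IH.
Qed.
End Relations.

(** * Right exactness and flatness *)

Section RightExact.
Variable R : pzRingType.

Definition tspan (A : lmodType R^c) (M : lmodType R) (P : A -> M -> Prop)
  (t : tensor A M) : Prop :=
  exists L : seq (A * M), (forall p, List.In p L -> P p.1 p.2) /\
    t = \sum_(p <- L) tens p.1 p.2.

Section TSpan.
Variables (A : lmodType R^c) (M : lmodType R) (P : A -> M -> Prop).
Lemma tspan0 : tspan P 0.
Proof. by exists [::]; rewrite big_nil. Qed.
Lemma tspanD t t' : tspan P t -> tspan P t' -> tspan P (t + t').
Proof.
move=> [L [h ->]] [L' [h' ->]]; exists (L ++ L'); split; last by rewrite big_cat.
by move=> p; rewrite List.in_app_iff => -[]; [apply: h|apply: h'].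
Qed.
Lemma tspan1 a m : P a m -> tspan P (tens a m).
Proof. by move=> h; exists [:: (a, m)]; split; [move=> p [<-|]|rewrite big_seq1]. Qed.
Lemma tspan_sum (I : Type) (s : seq I) (F : I -> tensor A M) :
  (forall i, tspan P (F i)) -> tspan P (\sum_(i <- s) F i).
Proof.
move=> h; elim: s => [|i s IH]; first by rewrite big_nil; apply: tspan0.
by rewrite big_cons; apply: tspanD.
Qed.
Lemma tspan_subgroup : (forall a m, P a m -> P (- a) m) -> subgroup (tspan P).
Proof.
move=> hN; split; first exact: tspan0.
move=> x y hx [L [h ->]]; apply: tspanD => //; rewrite -sumrN.
exists [seq (- p.1, p.2) | p <- L]; split.
  by move=> p; rewrite List.in_map_iff => -[q [<- hq]]; apply/hN/h.
by rewrite big_map; apply: eq_bigr => p _; rewrite tensNl.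
Qed.
End TSpan.

Lemma tsurj (A B : lmodType R^c) (M N : lmodType R) (g : {linear A -> B})
  (f : {linear M -> N}) : surj g -> surj f -> surj (tensor_map g f).
Proof.
move=> /choice [s hs] /choice [s' hs'] t; have [L ->] := tens_list t.
exists (\sum_(p <- L) tens (s p.1) (s' p.2)); rewrite tmap_sum.
by apply: eq_bigr => p _; rewrite hs hs'.
Qed.

Lemma tsurj_r (A : lmodType R^c) (M N : lmodType R) (f : {linear M -> N}) :
  surj f -> surj (tensor_map (idl A) f).
Proof. by apply: tsurj => x; exists x. Qed.

(** The map b of [tensor_zero_witness] is a (x) s p, for a set-theoretic section s
of g: it respects all relations modulo the tensors with second factor in ker g. *)
Lemma tker_r (A : lmodType R^c) (N P : lmodType R) (g : {linear N -> P}) :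
  surj g -> forall t, tensor_map (idl A) g t = 0 -> tspan (fun _ n => g n = 0) t.
Proof.
move=> sg t; have [L ->] := tens_list t; rewrite tmap_sum => h0.
pose L' := [seq (p.1, g p.2) | p <- L].
have /tensor_zero_witness [C hC] : \sum_(p <- L') tens p.1 p.2 = 0 by rewrite big_map.
have [s hs] := choice sg.
have sH : subgroup (tspan (fun (_ : A) n => g n = 0)) by apply: tspan_subgroup.
have d (a : A) n n' : g n = g n' -> tspan (fun (_ : A) n => g n = 0) (tens a n - tens a n').
  by move=> e; rewrite -tensNr -tensDr; apply: tspan1; rewrite linearB e subrr.
have hc : List.Forall (sat (tspan (fun (_ : A) n => g n = 0)) (fun a p => tens a (s p))) C.
  apply/List.Forall_forall => -[a a' m|a m m'|r a m] _ /=.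
  - by rewrite tensDl addrAC addrK subrr; apply: tspan0.
  - by rewrite -addrA -opprD -tensDr; apply: d; rewrite linearD !hs.
  - by rewrite tensZ; apply: d; rewrite linearZ_LR !hs.
have := hC _ _ _ sH hc; rewrite big_map /= => h1.
rewrite -[X in tspan _ X](subrK (\sum_(i <- L) tens i.1 (s (g i.2)))).
apply: tspanD => //; rewrite -sumrB; apply: tspan_sum => p.
by apply: d; rewrite hs.
Qed.

Lemma tker_l (A B : lmodType R^c) (N : lmodType R) (g : {linear A -> B}) :
  surj g -> forall t, tensor_map g (idl N) t = 0 -> tspan (fun a _ => g a = 0) t.
Proof.
move=> sg t; have [L ->] := tens_list t; rewrite tmap_sum => h0.
pose L' := [seq (g p.1, p.2) | p <- L].
have /tensor_zero_witness [C hC] : \sum_(p <- L') tens p.1 p.2 = 0 by rewrite big_map.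
have [s hs] := choice sg.
have sH : subgroup (tspan (fun a (_ : N) => g a = 0)).
  by apply: tspan_subgroup => a _ h; rewrite linearN h oppr0.
have d (a a' : A) (n : N) : g a = g a' -> tspan (fun a (_ : N) => g a = 0) (tens a n - tens a' n).
  by move=> e; rewrite -tensNl -tensDl; apply: tspan1; rewrite linearB e subrr.
have hc : List.Forall (sat (tspan (fun a (_ : N) => g a = 0)) (fun a p => tens (s a) p)) C.
  apply/List.Forall_forall => -[a a' m|a m m'|r a m] _ /=.
  - by rewrite -addrA -opprD -tensDl; apply: d; rewrite linearD !hs.
  - by rewrite tensDr addrAC addrK subrr; apply: tspan0.
  - by rewrite -tensZ; apply: d; rewrite linearZ_LR !hs.
have := hC _ _ _ sH hc; rewrite big_map /= => h1.
rewrite -[X in tspan _ X](subrK (\sum_(i <- L) tens (s (g i.1)) i.2)).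
apply: tspanD => //; rewrite -sumrB; apply: tspan_sum => p.
by apply: d; rewrite hs.
Qed.

Lemma tspan_img_r (A : lmodType R^c) (M N : lmodType R) (f : {linear M -> N}) (P : A -> N -> Prop) t :
  (forall a n, P a n -> exists m, f m = n) -> tspan P t ->
  exists s, tensor_map (idl A) f s = t.
Proof.
move=> h [L [hL ->]]; elim: L hL => [|p L IH] hL.
  by exists 0; rewrite tmap0 big_nil.
have [m em] : exists m, f m = p.2 by apply: (h p.1); apply: hL; left.
have [s es] : exists s, tensor_map (idl A) f s = \sum_(p <- L) tens p.1 p.2.
  by apply: IH => q hq; apply: hL; right.
by exists (tens p.1 m + s); rewrite tmapD tensor_mapE em es big_cons.
Qed.

Lemma tspan_img_l (A B : lmodType R^c) (N : lmodType R) (f : {linear A -> B}) (P : B -> N -> Prop) t :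
  (forall a n, P a n -> exists m, f m = a) -> tspan P t ->
  exists s, tensor_map f (idl N) s = t.
Proof.
move=> h [L [hL ->]]; elim: L hL => [|p L IH] hL.
  by exists 0; rewrite tmap0 big_nil.
have [m em] : exists m, f m = p.1 by apply: (h _ p.2); apply: hL; left.
have [s es] : exists s, tensor_map f (idl N) s = \sum_(p <- L) tens p.1 p.2.
  by apply: IH => q hq; apply: hL; right.
by exists (tens m p.2 + s); rewrite tmapD tensor_mapE em es big_cons.
Qed.

Lemma texact_r (A : lmodType R^c) (M N P : lmodType R) (f : {linear M -> N}) (g : {linear N -> P}) :
  exact f g -> surj g -> exact (tensor_map (idl A) f) (tensor_map (idl A) g).
Proof.
move=> e sg t; split=> [h|[s <-]].
  by apply: tspan_img_r (tker_r sg h) => _ n /e.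
rewrite (@tmap_comp _ _ _ _ _ _ _ _ _ _ _ (idl A) \0) //; last by move=> m; apply/e; exists m.
exact: tmap_0.
Qed.

Lemma texact_l (A B C : lmodType R^c) (N : lmodType R) (f : {linear A -> B}) (g : {linear B -> C}) :
  exact f g -> surj g -> exact (tensor_map f (idl N)) (tensor_map g (idl N)).
Proof.
move=> e sg t; split=> [h|[s <-]].
  by apply: tspan_img_l (tker_l sg h) => b _ /e.
have [L ->] := tens_list s; rewrite !tmap_sum big1 // => p _.
by have /e -> : exists a, f a = f p.1 by [exists p.1]; rewrite tens0l.
Qed.

Lemma flat_inj (M : lmodType R) : flat M ->
  forall (A B : lmodType R^c) (f : {linear A -> B}), injective f ->
  injective (tensor_map f (idl M)).
Proof.
move=> fM A B f fi; apply: inj0P => t h.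
have e : exact (\0 : {linear A -> A}) f.
  move=> a; split=> [/eqP|[b <-]]; last by rewrite linear0.
  by rewrite -(linear0 f) => /eqP /fi ->; exists 0.
have /(fM _ _ _ _ _ e) [s <-] := h.
have [L ->] := tens_list s; rewrite !tmap_sum big1 // => p _.
exact: tens0l.
Qed.

(** An exact A -> B -> C factors through the injection of B / im A into C, and
tensoring is right exact. *)
Lemma flat_of_inj (M : lmodType R) :
  (forall (A B : lmodType R^c) (f : {linear A -> B}), injective f ->
     forall t, tensor_map f (idl M) t = 0 -> t = 0) -> flat M.
Proof.
move=> h A B C f g e t.
pose q := qpi (imgm f).
have [g' hg'] : exists g' : {linear quot (imgm f) -> C}, forall b, g' (q b) = g b.
  apply: surj_factor; first exact: qpi_surj.
  by move=> b /qpi0P /= hb; apply/e.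
have eq : exact f q by move=> b; apply: qpi0P.
have [h1 h2] := texact_l (N := M) eq (@qpi_surj _ _ _) t.
split=> [ht|/h2 ht].
  apply: h1; apply: (h _ _ g').
    apply: linj => y; have [b <-] := @qpi_surj _ _ _ y.
    by rewrite hg' => /e hb; apply: qpi0.
  by rewrite (tmap_comp (h := g) (k := idl M)).
rewrite -(tmap_comp (g := q) (f := idl M) (g' := g') (f' := idl M)) //.
by rewrite ht tmap0.
Qed.

End RightExact.

(** * The class of AC-acyclic complexes of flat modules *)

Section Complexes.
Variable R : pzRingType.
Notation cx := (int_sequence R).

Record cmap (X Y : cx) := CMap {
  cmf :> forall i, {linear X i -> Y i};
  cmd : forall i x, cmf i (seq_d X i x) = seq_d Y i (cmf (i + 1) x)
}.

Definition cmap_id (X : cx) : cmap X X := CMap (cmf := fun i => idl (X i)) (fun i x => erefl).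

Fact cmap_comp_d (X Y Z : cx) (g : cmap Y Z) (f : cmap X Y) i x :
  (g i \o f i) (seq_d X i x) = seq_d Z i ((g (i + 1) \o f (i + 1)) x).
Proof. by rewrite /= !cmd. Qed.
Definition cmap_comp (X Y Z : cx) (g : cmap Y Z) (f : cmap X Y) : cmap X Z :=
  @CMap X Z (fun i => g i \o f i) (cmap_comp_d g f).

(** Tensoring with the right module R is the identity, so that exactness of a
complex is a case of exactness of a tensored complex. *)
Definition rreg : lmodType R^c := (R^c)^o.

Definition test_module (A : lmodType R^c) : Prop := abs_clean A \/ A = rreg.

Definition acflat (X : cx) : Prop :=
  (forall i, flat (X i)) /\ (forall A, test_module A -> tensor_exact A X).

Section Regular.
Variable X : cx.

Lemma rreg_tens (M : lmodType R) (t : tensor rreg M) : exists m, t = tens (1 : rreg) m.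
Proof.
have [L ->] := tens_list t; exists (\sum_(p <- L) (p.1 : R) *: p.2).
elim: L => [|[r m] L IH]; first by rewrite !big_nil tens0r.
rewrite !big_cons IH tensDr; congr (_ + _) => /=.
rewrite -tensZ; congr tens.
by rewrite -[LHS](mul1r (r : R)).
Qed.

Lemma rreg_bal (M : lmodType R) : balanced (fun (r : rreg) (m : M) => (r : R) *: m).
Proof.
split=> [a a' m|a m m'|r a m]; rewrite ?scalerDl ?scalerDr ?scalerA //.
Qed.

Lemma rreg_tens_inj (M : lmodType R) (m : M) : tens (1 : rreg) m = 0 -> m = 0.
Proof.
move=> h; have e := tensor_liftE (@rreg_bal M) 1 m; rewrite h in e.
rewrite scale1r in e; rewrite -e.
have := tensor_lift_is_zmod_morphism (@rreg_bal M) 0 0.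
by rewrite !subrr.
Qed.

Lemma rreg_exact : tensor_exact rreg X <-> exact_complex X.
Proof.
split=> h i.
  move=> x; split=> [hx|[y <-]].
    have /(h i) [s] : tensor_map (idl rreg) (seq_d X i) (tens (1 : rreg) x) = 0.
      by rewrite tensor_mapE hx tens0r.
    have [y ->] := rreg_tens s; rewrite tensor_mapE => e; exists y.
    apply/eqP; rewrite -subr_eq0; apply/eqP/rreg_tens_inj.
    by rewrite tensDr tensNr e subrr.
  apply: rreg_tens_inj.
  have /(h i) : exists s, tensor_map (idl rreg) (seq_d X (i+1)) s = tens (1 : rreg) (seq_d X (i+1) y).
    by exists (tens (1 : rreg) y); rewrite tensor_mapE.
  by rewrite tensor_mapE.
move=> t; have [x ->] := rreg_tens t; rewrite tensor_mapE; split.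
  by move/rreg_tens_inj/h => [y <-]; exists (tens (1 : rreg) y); rewrite tensor_mapE.
move=> [s]; have [y ->] := rreg_tens s; rewrite tensor_mapE => e.
have -> : x = seq_d X (i + 1) y.
  apply/eqP; rewrite -subr_eq0; apply/eqP/rreg_tens_inj.
  by rewrite tensDr tensNr -e subrr.
have /h -> : exists z, seq_d X (i+1) z = seq_d X (i + 1) y by exists y.
exact: tens0r.
Qed.
End Regular.

Lemma acflat_exact X : acflat X -> exact_complex X.
Proof. by move=> [_ h]; apply/rreg_exact/h; right. Qed.

Lemma acflat_dd X : acflat X -> forall i x, seq_d X i (seq_d X (i + 1) x) = 0.
Proof. by move=> /acflat_exact h i x; apply/h; exists x. Qed.

(** ** Subcomplexes and quotients *)

(** Subcomplexes are families of predicates rather than complexes, so that they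
can be compared and united. *)
Record subcx (X : cx) := Subcx {
  sk :> forall i, submod (X i);
  skd : forall i x, sk (i + 1) x -> sk i (seq_d X i x)
}.

Section QuotCx.
Variables (X : cx) (K : subcx X).

Fact qd_ex i : exists h : {linear quot (K (i + 1)) -> quot (K i)},
  forall x, h (qpi (K (i + 1)) x) = (qpi (K i) \o seq_d X i) x.
Proof.
apply: surj_factor => [|x]; first exact: qpi_surj.
by move=> /qpi0P h; apply/qpi0/skd.
Qed.
Definition qd i := projT1 (cid (qd_ex i)).
Definition qcx : cx := IntSequence qd.
Lemma qdE i x : seq_d qcx i (qpi (K (i + 1)) x) = qpi (K i) (seq_d X i x).
Proof. exact: (projT2 (cid (qd_ex i)) x). Qed.
Definition qcpi : cmap X qcx :=
  @CMap X qcx (fun i => qpi (K i)) (fun i x => esym (qdE x)).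

Lemma qcx_lift (Y : cx) (f : cmap X Y) : (forall i x, K i x -> f i x = 0) ->
  exists g : cmap qcx Y, forall i x, g i (qpi (K i) x) = f i x.
Proof.
move=> h.
have E i : exists g : {linear quot (K i) -> Y i}, forall x, g (qpi (K i) x) = f i x.
  by apply: surj_factor; [exact: qpi_surj|move=> x /qpi0P /h].
pose g i := projT1 (cid (E i)).
have gE i x : g i (qpi (K i) x) = f i x by exact: (projT2 (cid (E i)) x).
have gd i (x : qcx (i + 1)) : g i (seq_d qcx i x) = seq_d Y i (g (i + 1) x).
  by have [y <-] := qpi_surj x; rewrite qdE !gE cmd.
by exists (@CMap qcx Y g gd).
Qed.
End QuotCx.

Fact imgcx_d (N Y : cx) (io : cmap N Y) i y :
  imgm (io (i + 1)) y -> imgm (io i) (seq_d Y i y).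
Proof. by move=> [n <-]; exists (seq_d N i n); rewrite cmd. Qed.
Definition imgcx (N Y : cx) (io : cmap N Y) : subcx Y :=
  @Subcx Y (fun i => imgm (io i)) (imgcx_d (io := io)).

Fact kercx_d (N Y : cx) (f : cmap N Y) i x :
  kerm (f (i + 1)) x -> kerm (f i) (seq_d N i x).
Proof. by rewrite /= cmd => ->; rewrite linear0. Qed.
Definition kercx (N Y : cx) (f : cmap N Y) : subcx N :=
  @Subcx N (fun i => kerm (f i)) (kercx_d (f := f)).

Section SubCx.
Variables (X : cx) (K : subcx X).
Fact sd_ex i : exists h : {linear subm (K (i + 1)) -> subm (K i)},
  forall x, sincl (K i) (h x) = (seq_d X i \o sincl (K (i + 1))) x.
Proof.
apply: inj_factor => [|x]; first exact: sincl_inj.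
by apply/sincl_ex/skd/sinclP.
Qed.
Definition sd i := projT1 (cid (sd_ex i)).
Definition scx : cx := IntSequence sd.
Lemma sdE i (x : scx (i + 1)) :
  sincl (K i) (seq_d scx i x) = seq_d X i (sincl (K (i + 1)) x).
Proof. exact: (projT2 (cid (sd_ex i)) x). Qed.
Definition scincl : cmap scx X := @CMap scx X (fun i => sincl (K i)) (fun i x => sdE x).
End SubCx.

Section DSumCx.
Variables (I : choiceType) (X : I -> cx).
Fact dsd_ex i : exists h : {linear dsum (fun k => X k (i + 1)) -> dsum (fun k => X k i)},
  forall k x, h (dinj k x) = (dinj k \o seq_d (X k) i) x.
Proof. exact: dsum_lift (fun k => dinj k \o seq_d (X k) i). Qed.
Definition dsd i := projT1 (cid (dsd_ex i)).
Definition dscx : cx := IntSequence dsd.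
Lemma dsdE i k x : seq_d dscx i (dinj (X := fun k => X k (i + 1)) k x) =
  dinj (X := fun k => X k i) k (seq_d (X k) i x).
Proof. exact: (projT2 (cid (dsd_ex i)) k x). Qed.
Definition dcinj k : cmap (X k) dscx :=
  @CMap (X k) dscx (fun i => dinj (X := fun k => X k i) k) (fun i x => esym (dsdE x)).

Lemma dsd_proj i (f : dscx (i + 1)) k : seq_d dscx i f k = seq_d (X k) i (f k).
Proof.
elim/dsum_ind: f => [|j x f IH]; first by rewrite !linear0.
rewrite !linearD -!dprojE !linearD !dprojE IH; congr (_ + _).
rewrite dsdE; have [e|jk] := eqVneq j k; last by rewrite !dinj0 // linear0.
by subst j; rewrite !dinjE.
Qed.
Fact dcproj_d k i (x : dscx (i + 1)) :
  dproj (X := fun k => X k i) k (seq_d dscx i x) = seq_d (X k) i (dproj (X := fun k => X k (i+1)) k x).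
Proof. by rewrite !dprojE dsd_proj. Qed.
Definition dcproj k : cmap dscx (X k) := @CMap dscx (X k) _ (dcproj_d k).

Lemma dscx_lift (Y : cx) (f : forall k, cmap (X k) Y) :
  exists g : cmap dscx Y, forall i k x, g i (dinj (X := fun k => X k i) k x) = f k i x.
Proof.
pose E i := dsum_lift (fun k => f k i).
pose g i := projT1 (cid (E i)).
have gE i k x : g i (dinj k x) = f k i x by exact: (projT2 (cid (E i)) k x).
have gd i (x : dscx (i + 1)) : g i (seq_d dscx i x) = seq_d Y i (g (i + 1) x).
  elim/dsum_ind: x => [|k x h IH]; first by rewrite !linear0.
  by rewrite !linearD IH dsdE !gE cmd.
by exists (@CMap dscx Y g gd).
Qed.
End DSumCx.
End Complexes.

(** * Closure properties of the class *)

Section Closure.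
Variable R : pzRingType.
Notation cx := (int_sequence R).
Notation tm A f := (tensor_map (idl A) f) (only parsing).

Lemma flat_retract (M N : lmodType R) (a : {linear M -> N}) (b : {linear N -> M}) :
  (forall x, b (a x) = x) -> flat N -> flat M.
Proof.
move=> ab fN; apply: flat_of_inj => A B f fi t h.
have <- : tm A b (tm A a t) = t.
  rewrite (tmap_comp (h := idl A) (k := b \o a)) //.
  by apply: tmap_id => // x; apply: ab.
suff -> : tm A a t = 0 by rewrite tmap0.
apply: (flat_inj fN fi); rewrite tmap0.
by rewrite (tmap_comm (h := f) (k := idl M) (h' := idl B) (k' := a)) // h tmap0.
Qed.

Lemma acflat_retract (X Y : cx) (a : cmap X Y) (b : cmap Y X) :
  (forall i x, b i (a i x) = x) -> acflat Y -> acflat X.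
Proof.
move=> ab [fY eY]; split=> [i|A hA i t].
  exact: flat_retract (ab i) (fY i).
have ba j (s : tensor A (X j)) : tm A (b j) (tm A (a j) s) = s.
  rewrite (tmap_comp (h := idl A) (k := b j \o a j)) //.
  by apply: tmap_id => // x; apply: ab.
have ca j (s : tensor A (X (j + 1))) :
    tm A (a j) (tm A (seq_d X j) s) = tm A (seq_d Y j) (tm A (a (j + 1)) s).
  by apply: tmap_comm => // x; rewrite cmd.
have cb j (s : tensor A (Y (j + 1))) :
    tm A (b j) (tm A (seq_d Y j) s) = tm A (seq_d X j) (tm A (b (j + 1)) s).
  by apply: tmap_comm => // x; rewrite cmd.
split=> [h|[s <-]].
  have /(eY A hA i) [s es] : tm A (seq_d Y i) (tm A (a (i + 1)) t) = 0.
    by rewrite -ca h tmap0.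
  by exists (tm A (b (i + 1 + 1)) s); rewrite -cb es ba.
rewrite -(ba i (tm A (seq_d X i) _)) !ca.
have /(eY A hA i) -> : exists s', tm A (seq_d Y (i + 1)) s' =
    tm A (seq_d Y (i + 1)) (tm A (a (i + 1 + 1)) s) by eexists.
by rewrite tmap0.
Qed.

Section DirectSum.
Variables (I : choiceType) (X : I -> lmodType R) (A : lmodType R^c).
Notation T := (tensor A (dsum X)).

(** Only finitely many components occur in the finitely many elements of the
direct sum from which t is built. *)
Lemma tdsum_decomp (t : T) : exists s : seq I,
  t = \sum_(k <- s) tm A (dinj (X := X) k) (tm A (dproj (X := X) k) t).
Proof.
have [L ->] := tens_list t.
have [s hs] : exists s : seq I, forall p, List.In p L -> forall k, k \notin s -> p.2 k = 0.
  elim: L {t} => [|[a f] L [s IH]]; first by exists [::].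
  have [s' h'] := dfin f; exists (s' ++ s) => p [<-|hp] k; rewrite mem_cat negb_or.
    by move=> /andP [/h'].
  by move=> /andP [_]; apply: IH.
exists (undup s).
elim: L hs {t} => [|[a f] L IH] hs.
  by rewrite !big_nil big1 // => k _; rewrite !tmap0.
rewrite [in LHS]big_cons IH; last by move=> p hp; apply: hs; right.
under [in RHS]eq_bigr do rewrite big_cons !tmapD !tensor_mapE.
rewrite big_split /=; congr (_ + _).
have hf k : k \notin undup s -> f k = 0.
  by rewrite mem_undup; apply: (hs (a, f)); left.
rewrite {1}(dsum_decomp (undup_uniq s) hf).
elim: (undup s) => [|k r IHr]; first by rewrite !big_nil tens0r.
by rewrite !big_cons tensDr IHr dprojE.
Qed.

Lemma tdsum_eq0 (t : T) : (forall k, tm A (dproj (X := X) k) t = 0) -> t = 0.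
Proof.
move=> h; have [s e] := tdsum_decomp t; rewrite e big1 // => k _.
by rewrite h tmap0.
Qed.
End DirectSum.

Lemma flat_dsum (I : choiceType) (X : I -> lmodType R) :
  (forall k, flat (X k)) -> flat (dsum X).
Proof.
move=> fX; apply: flat_of_inj => A B f fi t h; apply: tdsum_eq0 => k.
apply: (flat_inj (fX k) fi); rewrite tmap0.
rewrite (tmap_comm (h := f) (k := idl _) (h' := idl B) (k' := dproj (X := X) k)) //.
by rewrite h tmap0.
Qed.

Lemma acflat_dscx (I : choiceType) (X : I -> cx) : (forall k, acflat (X k)) -> acflat (dscx X).
Proof.
move=> h; split=> [i|A hA i t]; first by apply: flat_dsum => k; apply: (h k).1.
have cp j k (s : tensor A (dscx X (j + 1))) :
    tm A (dcproj X k j) (tm A (seq_d (dscx X) j) s) =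
    tm A (seq_d (X k) j) (tm A (dcproj X k (j + 1)) s).
  by apply: tmap_comm => // x; rewrite cmd.
have ci j k (s : tensor A (X k (j + 1))) :
    tm A (dcinj X k j) (tm A (seq_d (X k) j) s) =
    tm A (seq_d (dscx X) j) (tm A (dcinj X k (j + 1)) s).
  by apply: tmap_comm => // x; rewrite cmd.
split=> [ht|[s <-]].
  have E k : exists s, tm A (seq_d (X k) (i + 1)) s = tm A (dcproj X k (i + 1)) t.
    by apply/((h k).2 A hA i); rewrite -cp ht tmap0.
  have [s hs] := dep_choice E.
  have [r ->] := tdsum_decomp t.
  exists (\sum_(k <- r) tm A (dcinj X k _) (s k)); rewrite tmap_bigsum.
  by apply: eq_bigr => k _; rewrite -ci hs.
apply: tdsum_eq0 => k; rewrite (cp i) (cp (i + 1)).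
by apply/((h k).2 A hA i); eexists.
Qed.

(** A chain of quotients X / K k has colimit X / U, and both flatness and
   acyclicity are detected at some finite stage. *)
Lemma acflat_chain (J : Type) (X : cx) (K : J -> subcx X) (U : subcx X) :
  inhabited J ->
  (forall j k, (forall i x, K j i x -> K k i x) \/ (forall i x, K k i x -> K j i x)) ->
  (forall i x, U i x <-> exists k, K k i x) ->
  (forall k, acflat (qcx (K k))) -> acflat (qcx U).
Proof.
move=> [j0] ch hU gK.
pose pi := qcpi U; pose pk k := qcpi (K k).
have [ro hro] : exists ro : forall k, cmap (qcx (K k)) (qcx U),
    forall k i x, ro k i (pk k i x) = pi i x.
  have E k : exists g : cmap (qcx (K k)) (qcx U), forall i x, g i (pk k i x) = pi i x.
    by apply: qcx_lift => i x h; apply/qpi0/hU; exists k.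
  by have [g hg] := dep_choice E; exists g.
have stage (B : lmodType R^c) i (y : tensor B (X i)) :
    tm B (pi i) y = 0 -> exists k, tm B (pk k i) y = 0.
  move=> h; have [L [hL ->]] := tker_r (@qpi_surj _ _ (U i)) h.
  have [k hk] : exists k, forall p, List.In p L -> K k i p.2.
    elim: L hL => [|p L IH] hL; first by exists j0.
    have [k hk] : exists k, forall p, List.In p L -> K k i p.2.
      by apply: IH => q hq; apply: hL; right.
    have [j hj] : exists j, K j i p.2 by apply/hU/qpi0P/hL; left.
    have [c|c] := ch k j; [exists j|exists k] => q [<-|hq] //; [exact/c/hk|exact/c|exact/hk].
  exists k; rewrite tmap_sum big_seq_cond.
  elim: L hL hk => [|p L IH] hL hk; first by rewrite -big_seq_cond big_nil.
  rewrite -big_seq_cond big_cons (_ : pk k i p.2 = 0) ?tens0r ?add0r; last first.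
    by apply/qpi0/hk; left.
  by rewrite big_seq_cond; apply: IH => q hq; [apply: hL|apply: hk]; right.
have roE (B : lmodType R^c) i k (y : tensor B (X i)) :
    tm B (ro k i) (tm B (pk k i) y) = tm B (pi i) y.
  by apply: tmap_comp => // x; rewrite -hro.
split=> [i|A hA i t].
  apply: flat_of_inj => A B f fi t.
  have [y <-] := tsurj_r (A := A) (@qpi_surj _ _ (U i)) t => h.
  have [k hk] : exists k, tm B (pk k i) (tensor_map f (idl _) y) = 0.
    apply: stage; rewrite -[RHS]h; exact: tmap_comm.
  have h2 : tm A (pk k i) y = 0.
    apply: (flat_inj ((gK k).1 i) fi); rewrite tmap0 -[RHS]hk; exact: tmap_comm.
  by rewrite -[LHS](roE _ _ k) h2 tmap0.
have cpi j (s : tensor A (X (j + 1))) :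
    tm A (pi j) (tm A (seq_d X j) s) = tm A (seq_d (qcx U) j) (tm A (pi (j + 1)) s).
  by apply: tmap_comm => // x; rewrite cmd.
have cpk k j (s : tensor A (X (j + 1))) :
    tm A (pk k j) (tm A (seq_d X j) s) = tm A (seq_d (qcx (K k)) j) (tm A (pk k (j + 1)) s).
  by apply: tmap_comm => // x; rewrite cmd.
have cro k j (s : tensor A (qcx (K k) (j + 1))) :
    tm A (ro k j) (tm A (seq_d (qcx (K k)) j) s) = tm A (seq_d (qcx U) j) (tm A (ro k (j + 1)) s).
  by apply: tmap_comm => // x; rewrite cmd.
split=> [|[s <-]].
  have [y <-] := tsurj_r (A := A) (@qpi_surj _ _ (U (i + 1))) t => h.
  have [k hk] : exists k, tm A (pk k i) (tm A (seq_d X i) y) = 0.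
    by apply: stage; rewrite cpi.
  rewrite cpk in hk; have /((gK k).2 A hA i) [z hz] := hk.
  by exists (tm A (ro k _) z); rewrite -cro hz roE.
have [y <-] := tsurj_r (A := A) (@qpi_surj _ _ (U (i + 1 + 1))) s.
rewrite -(cpi (i + 1)) -(roE A (i + 1) j0) -cro.
rewrite (_ : tm A (seq_d _ i) _ = 0) ?tmap0 //.
by apply/((gK j0).2 A hA i); rewrite cpk; eexists.
Qed.

(** Purity makes the tensored sequence 0 -> N -> Y -> Q -> 0 exact, so that
   flatness and acyclicity pass to the quotient. *)
Lemma acflat_pure (N Y : cx) (io : cmap N Y) (K : subcx Y) :
  (forall (B : lmodType R^c) i, injective (tensor_map (idl B) (io i))) ->
  (forall A, test_module A -> tensor_exact A N) ->
  (forall i y, K i y <-> exists n, io i n = y) ->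
  acflat Y -> acflat (qcx K).
Proof.
move=> pu eN hK [fY eY].
pose pi := qcpi K.
have lift (B : lmodType R^c) i (y : tensor B (Y i)) :
    tm B (pi i) y = 0 -> exists n, tm B (io i) n = y.
  move=> h; have := tker_r (@qpi_surj _ _ (K i)) h.
  by apply: tspan_img_r => _ y' /qpi0P /hK.
have pio (B : lmodType R^c) i (n : tensor B (N i)) : tm B (pi i) (tm B (io i) n) = 0.
  rewrite (tmap_comp (h := idl B) (k := pi i \o io i)) //.
  by apply: tmap_0 => m; apply/qpi0/hK; exists m.
have pis (B : lmodType R^c) i (t : tensor B (qcx K i)) : exists y, tm B (pi i) y = t.
  exact: (tsurj_r (A := B) (@qpi_surj _ _ (K i))).
split=> [i|A hA i t].
  apply: flat_of_inj => A B f fi t; have [y <-] := pis _ _ t => h.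
  have [n hn] : exists n, tm B (io i) n = tensor_map f (idl _) y.
    apply: lift; rewrite -[RHS]h; exact: tmap_comm.
  pose q := qpi (imgm f).
  have hq0 M (s : tensor A M) : tensor_map q (idl M) (tensor_map f (idl M) s) = 0.
    have [L ->] := tens_list s; rewrite !tmap_sum big1 // => p _.
    by rewrite (_ : q _ = 0) ?tens0l //; apply/qpi0; exists p.1.
  have qn : tensor_map q (idl _) n = 0.
    apply: (pu _ i); rewrite tmap0 -[RHS](hq0 _ y) -hn; exact: tmap_comm.
  have [n' en] : exists n', tensor_map f (idl _) n' = n.
    by apply: tspan_img_l (tker_l (@qpi_surj _ _ _) qn) => b _ /qpi0P.
  have -> : y = tm A (io i) n'.
    apply: (flat_inj (fY i) fi); rewrite -hn -en; exact: tmap_comm.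
  exact: pio.
have cpi j (s : tensor A (Y (j + 1))) :
    tm A (pi j) (tm A (seq_d Y j) s) = tm A (seq_d (qcx K) j) (tm A (pi (j + 1)) s).
  by apply: tmap_comm => // x; rewrite cmd.
have cio j (s : tensor A (N (j + 1))) :
    tm A (io j) (tm A (seq_d N j) s) = tm A (seq_d Y j) (tm A (io (j + 1)) s).
  by apply: tmap_comm => // x; rewrite cmd.
have dd j (s : tensor A (Y (j + 1 + 1))) : tm A (seq_d Y j) (tm A (seq_d Y (j + 1)) s) = 0.
  by apply/(eY A hA j); eexists.
split=> [|[s <-]]; last first.
  have [y <-] := pis _ _ s; by rewrite -(cpi (i + 1)) -(cpi i) dd tmap0.
have [y <-] := pis _ _ t => h.
have [k ek] : exists k : int, i = k + 1 by exists (i - 1); rewrite subrK.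
subst i.
have [n hn] : exists n, tm A (io (k + 1)) n = tm A (seq_d Y (k + 1)) y.
  by apply: lift; rewrite cpi.
have /(eN A hA k) [n' hn'] : tm A (seq_d N k) n = 0.
  by apply: (pu _ k); rewrite tmap0 cio hn dd.
have /(eY A hA (k + 1)) [z hz] : tm A (seq_d Y (k + 1)) (y - tm A (io (k + 1 + 1)) n') = 0.
  by rewrite tmapB -cio hn' hn subrr.
exists (tm A (pi _) z); rewrite -cpi hz tmapB pio subr0 //.
Qed.
End Closure.

(** * Subcomplexes with local retractions *)

Section Terms.
Variable R : pzRingType.
Notation cx := (int_sequence R).
Notation tm A f := (tensor_map (idl A) f).

(** Formal elements of the subcomplex generated by a family of elements indexed by
V; two families satisfy the same relations when the same terms vanish on both. *)
Inductive term (V : int -> Type) : int -> Type :=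
| tvar i : V i -> term V i
| tzero i : term V i
| tlin i : R -> term V i -> term V i -> term V i
| tdif i : term V (i + 1) -> term V i.

Fixpoint term_eval (X : cx) V (s : forall i, V i -> X i) i (t : term V i) : X i :=
  match t with
  | tvar i v => s i v
  | tzero i => 0
  | tlin i r t t' => r *: term_eval s t + term_eval s t'
  | tdif i t => seq_d X i (term_eval s t)
  end.

(** The subcomplex generated by s has a retraction into D over psi: it sends the
value of a term at s to its value at s', and is well defined because 0 is in D,
so that a term that vanishes at s vanishes at s'. *)
Definition locally_retracts (V : int -> Type) (X : cx) (c : int) (T : Type) (psi : X c -> T)
  (D : subcx X) : Prop :=
  forall s : forall k, V k -> X k, exists s' : forall k, V k -> X k,
    [/\ forall k (t : term V k), D k (term_eval s' t),
        forall k (t : term V k), D k (term_eval s t) -> term_eval s' t = term_eval s t &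
        forall t : term V c, psi (term_eval s' t) = psi (term_eval s t)].

(** V has room for any finite family of elements in each degree. *)
Definition has_nats (V : int -> Type) : Prop :=
  forall k, exists (ka : V k -> nat) (se : nat -> V k), cancel se ka.

(** The map th is the retraction of the subcomplex generated by L, on the entries
of L, and 0 elsewhere; hence the restriction to relations all of whose members
are entries of L. *)
Lemma locally_retracts_finite (V : int -> Type) (X : cx) c T (psi : X c -> T) (D : subcx X) :
  has_nats V -> locally_retracts V psi D ->
  forall L : seq {k & X k}, exists th : forall k, X k -> X k,
    [/\ forall k x, D k (th k x),
        forall k x, List.In (existT _ k x) L -> D k x -> th k x = x,
        forall k x y, List.In (existT _ k x) L -> List.In (existT _ k y) L ->
          List.In (existT _ k (x + y)) L -> th k (x + y) = th k x + th k y,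
        forall k (r : R) x, List.In (existT _ k x) L ->
          List.In (existT _ k (r *: x)) L -> th k (r *: x) = r *: th k x &
        forall k x, List.In (existT _ (k + 1) x) L ->
          List.In (existT _ k (seq_d X k x)) L -> th k (seq_d X k x) = seq_d X k (th (k + 1) x)].
Proof.
move=> /dep_choice [ka /dep_choice [se hse]] rt L.
pose s k (v : V k) : X k :=
  if pselect (exists x, onth L (ka k v) = Some (existT _ k x)) is left h
  then projT1 (cid h) else 0.
have hs k (x : X k) : List.In (existT _ k x) L -> exists v, s k v = x.
  move=> hx; have [n hn] : exists n, onth L n = Some (existT _ k x).
    elim: L hx {s} => [//|y L IH] [->|/IH [n hn]]; first by exists 0%N.
    by exists n.+1.
  exists (se k n); rewrite /s hse; case: pselect => [h|[]]; last by exists x.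
  case: cid => y /=; rewrite hn => -[] e.
  by have := eq_from_Tagged e.
have [s' [h1 h2 _]] := rt s.
pose th k (x : X k) : X k :=
  if pselect (exists v, s k v = x) is left h then s' k (projT1 (cid h)) else 0.
have hth k x : List.In (existT _ k x) L -> exists v, s k v = x /\ th k x = s' k v.
  move=> /hs hx; rewrite /th; case: pselect => // h; exists (projT1 (cid h)).
  by split=> //; apply: (projT2 (cid h)).
have z k (t : term V k) : term_eval s t = 0 -> term_eval s' t = 0.
  by move=> e; rewrite h2 // e; apply: smem0.
exists th; split.
- move=> k x; rewrite /th; case: pselect => [h|_]; last exact: smem0.
  exact: (h1 k (tvar _)).
- move=> k x /hth [v [<- ->]] hx; exact: (h2 k (tvar v)).
- move=> k x y /hth [v [ev ->]] /hth [w [ew ->]] /hth [u [eu ->]].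
  have := z k (tlin (-1) (tvar u) (tlin 1 (tvar v) (tvar w))).
  rewrite /= eu ev ew scale1r scaleN1r addNr => /(_ erefl) /eqP.
  by rewrite scale1r scaleN1r addr_eq0 eqr_opp => /eqP.
- move=> k r x /hth [v [ev ->]] /hth [u [eu ->]].
  have := z k (tlin (-1) (tvar u) (tlin r (tvar v) (tzero V k))).
  rewrite /= eu ev !addr0 scaleN1r addNr => /(_ erefl) /eqP.
  by rewrite scaleN1r addr_eq0 eqr_opp => /eqP.
- move=> k x /hth [v [ev ->]] /hth [u [eu ->]].
  have := z k (tlin (-1) (tvar u) (tdif (tvar v))).
  rewrite /= eu ev scaleN1r addNr => /(_ erefl) /eqP.
  by rewrite scaleN1r addr_eq0 eqr_opp => /eqP.
Qed.

Definition rel_elts (A : lmodType R^c) (M : lmodType R) (c : rel_inst A M) : seq M :=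
  match c with
  | RDl a a' m => [:: m]
  | RDr a m m' => [:: m; m'; m + m']
  | RZ r a m => [:: m; r *: m]
  end.

Section Retr.
Variables (V : int -> Type) (X : cx) (c : int) (T : Type) (psi : X c -> T) (D : subcx X).
Hypotheses (hV : has_nats V) (rt : locally_retracts V psi D).

(** A vanishing sum in A (x) X i only involves finitely many linear relations,
   which local retractions move into D. *)
Lemma locally_retracts_transfer (A : lmodType R^c) i (L : seq (A * X i)) (E : seq (X (i + 1))) :
  \sum_(p <- L) tens p.1 p.2 = 0 ->
  exists (th : X i -> scx D i) (th' : X (i + 1) -> scx D (i + 1)),
    [/\ forall x, List.In (sincl (D i) x) (map snd L) -> th (sincl (D i) x) = x,
        forall x, List.In x E -> List.In (seq_d X i x) (map snd L) ->
           th (seq_d X i x) = seq_d (scx D) i (th' x) &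
        \sum_(p <- L) tens p.1 (th p.2) = 0].
Proof.
move=> /tensor_zero_witness [C hC].
pose W := map snd L ++ flatten (map (@rel_elts _ _) C).
pose S := map (existT (fun k => X k : Type) i) W ++ map (existT (fun k => X k : Type) (i + 1)) E.
have hW x : List.In x W -> List.In (existT _ i x) S.
  by move=> hx; apply/List.in_app_iff; left; apply: List.in_map.
have hE x : List.In x E -> List.In (existT _ (i + 1) x) S.
  by move=> hx; apply/List.in_app_iff; right; apply: List.in_map.
have hL x : List.In x (map snd L) -> List.In x W.
  by move=> hx; apply/List.in_app_iff; left.
have [t [t1 t2 t3 t4 t5]] := locally_retracts_finite hV rt S.
have [th hth] : exists th : X i -> subm (D i), forall x, sincl (D i) (th x) = t i x.
  by have [f hf] := choice (fun x => sincl_ex (t1 i x)); exists f.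
have [th' hth'] : exists th : X (i + 1) -> subm (D (i + 1)), forall x, sincl (D (i + 1)) (th x) = t (i + 1) x.
  by have [f hf] := choice (fun x => sincl_ex (t1 (i + 1) x)); exists f.
have si := @sincl_inj _ _ (D i).
exists th, th'; split.
- move=> x hx; apply: si; rewrite hth t2 //; last exact: sinclP.
  exact/hW/hL.
- by move=> x hx hdx; apply: si; rewrite hth sdE hth' t5 //; [exact: hE|exact/hW/hL].
- apply: (hC _ (fun x => x = 0) (fun a x => tens a (th x))).
    by split=> // x y -> ->; rewrite subr0.
  apply/List.Forall_forall => r hr.
  have {hr} hr x : List.In x (rel_elts r) -> List.In (existT _ i x) S.
    move=> hx; apply: hW; apply/List.in_app_iff; right.
    elim: C hr {hC W S hE hL t2 t3 t4 t5} => //= r' C IH [->|/IH h]; apply/List.in_app_iff; [by left|by right].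
  case: r hr => [a a' m|a m m'|r a m] hr /=.
  + by rewrite tensDl addrAC addrK subrr.
  + rewrite (_ : th (m + m') = th m + th m'); first by rewrite tensDr addrAC addrK subrr.
    apply: si; rewrite linearD !hth t3 //; apply: hr => /=; tauto.
  + rewrite (_ : th (r *: m) = r *: th m); first by rewrite tensZ subrr.
    apply: si; rewrite linearZ_LR !hth t4 //; apply: hr => /=; tauto.
Qed.

Lemma locally_retracts_pure (B : lmodType R^c) i :
  injective (tensor_map (idl B) (scincl D i)).
Proof.
apply: inj0P => t; have [L ->] := tens_list t => h.
have {}h : \sum_(p <- map (fun p => (p.1, sincl (D i) p.2)) L) tens p.1 p.2 = 0.
  by rewrite big_map -[RHS]h; apply: esym; apply: tmap_sum.
have [th [_ [h1 _]]] := locally_retracts_transfer [::] h; rewrite big_map => h2.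
rewrite -[RHS]h2.
elim: L h1 {h h2 t} => [|p L IH] h1; first by rewrite !big_nil.
rewrite !big_cons IH => [|x hx]; last by apply: h1; right.
by rewrite h1 //; left.
Qed.

(** If t = d z in A (x) X, then the finitely many relations that witness this move
with z into D. *)
Lemma locally_retracts_exact (A : lmodType R^c) : tensor_exact A X -> tensor_exact A (scx D).
Proof.
move=> eX i t.
have ci j (s : tensor A (scx D (j + 1))) :
    tm A (scincl D j) (tm A (seq_d (scx D) j) s) = tm A (seq_d X j) (tm A (scincl D (j + 1)) s).
  by apply: tmap_comm => // x; rewrite cmd.
split=> [|[s <-]]; last first.
  apply: (@locally_retracts_pure _ i); rewrite tmap0 (ci i) (ci (i + 1)).
  by apply/(eX i); eexists.
move=> ht.
have /(eX i) [z hz] : tm A (seq_d X i) (tm A (scincl D (i + 1)) t) = 0 by rewrite -ci ht tmap0.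
have [L eL] := tens_list t; have [Z eZ] := tens_list z.
pose L1 := map (fun p => (p.1, sincl (D (i + 1)) p.2)) L.
pose L2 := map (fun p => (- p.1, seq_d X (i + 1) p.2)) Z.
have h0 : \sum_(p <- L1 ++ L2) tens p.1 p.2 = 0.
  rewrite big_cat !big_map /=; apply/eqP; rewrite addr_eq0; apply/eqP.
  transitivity (tm A (scincl D (i + 1)) t); first by rewrite eL; apply/esym/tmap_sum.
  rewrite -hz eZ -sumrN; apply: (etrans (tmap_sum _ _ _ _ _)); apply: eq_bigr => p _.
  by rewrite tensNl opprK.
have [th [th' [h1 h2]]] := locally_retracts_transfer (map snd Z) h0.
rewrite big_cat !big_map /= => h3.
exists (\sum_(p <- Z) tens p.1 (th' p.2)); rewrite tmap_sum.
have -> : t = \sum_(p <- L) tens p.1 (th (sincl (D (i + 1)) p.2)).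
  rewrite {1}eL.
  have {}h1 p : List.In p L -> th (sincl (D (i + 1)) p.2) = p.2.
    move=> hp; apply: h1; rewrite map_cat; apply/List.in_app_iff; left.
    by rewrite -map_comp; apply: (List.in_map (fun p => sincl (D (i + 1)) p.2)).
  elim: L h1 {h0 h2 h3 eL L1} => [|p L IH] h1; first by rewrite !big_nil.
  rewrite !big_cons IH => [|x hx]; last by apply: h1; right.
  by rewrite h1 //; left.
apply/eqP; rewrite eq_sym -subr_eq0; apply/eqP; rewrite -[RHS]h3 -sumrN; congr (_ + _).
have {}h2 p : List.In p Z -> th (seq_d X (i + 1) p.2) = seq_d (scx D) (i + 1) (th' p.2).
  move=> hp; apply: h2; first exact: (List.in_map snd).
  rewrite map_cat; apply/List.in_app_iff; right.
  by rewrite -map_comp; apply: (List.in_map (fun p => seq_d X (i + 1) p.2)).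
elim: Z h2 {h0 h1 h3 eZ L2} => [|p Z IH] h2; first by rewrite !big_nil.
rewrite !big_cons IH => [|x hx]; last by apply: h2; right.
by rewrite h2 ?tensNl //; left.
Qed.

Lemma locally_retracts_good : acflat X -> acflat (qcx D).
Proof.
move=> gX; apply: (acflat_pure (io := scincl D)) => //.
- by move=> B i; apply: locally_retracts_pure.
- by move=> A hA; apply: locally_retracts_exact; apply: gX.2.
- move=> i y; split=> [/sincl_ex [n <-]|[n <-]]; first by exists n.
  exact: sinclP.
Qed.
End Retr.
End Terms.
Arguments tvar {R V i} v.
Arguments tzero {R} V i.
Arguments tlin {R V i}.
Arguments tdif {R V i}.

(** * Small subcomplexes with local retractions *)

Section Hull.
Variable R : pzRingType.
Notation cx := (int_sequence R).
Notation tm A f := (tensor_map (idl A) f) (only parsing).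

Section W.
Variables (V : int -> Type) (c : int) (T : Type).

(** Formal elements of a subcomplex that has local retractions.  A node stands for
the entry at v of a chosen family s that solves the system in which the terms in
inD take the prescribed values ch, and all terms the prescribed values pv under
psi. *)
Inductive wterm : int -> Type :=
| wbase i : V i -> wterm i
| wzero i : wterm i
| wlin i : R -> wterm i -> wterm i -> wterm i
| wdif i : wterm (i + 1) -> wterm i
| wnode i (v : V i) (inD : forall k, term R V k -> Prop) (pv : term R V c -> T)
    (ch : forall k, term R V k -> wterm k) : wterm i.

Variables (X : cx) (psi : X c -> T) (b : forall i, V i -> X i).

Definition solves (inD : forall k, term R V k -> Prop) (pv : term R V c -> T)
  (t : forall k, term R V k -> X k) (s : forall k, V k -> X k) : Prop :=
  (forall k u, inD k u -> term_eval s u = t k u) /\ (forall u, psi (term_eval s u) = pv u).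

Definition solution inD pv t : forall k, V k -> X k :=
  if pselect (exists s, solves inD pv t s) is left h then projT1 (cid h)
  else fun k _ => 0.

Lemma solutionP inD pv t : (exists s, solves inD pv t s) -> solves inD pv t (solution inD pv t).
Proof. by rewrite /solution; case: pselect => // h _; apply: (projT2 (cid h)). Qed.

Fixpoint wterm_eval i (w : wterm i) : X i :=
  match w with
  | wbase i v => b v
  | wzero i => 0
  | wlin i r w w' => r *: wterm_eval w + wterm_eval w'
  | wdif i w => seq_d X i (wterm_eval w)
  | wnode i v inD pv ch => solution inD pv (fun k u => wterm_eval (ch k u)) v
  end.

Fact hull0 i : exists w : wterm i, wterm_eval w = 0.
Proof. by exists (wzero i). Qed.
Fact hull_lin i (r : R) (x y : X i) : (exists w : wterm i, wterm_eval w = x) ->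
  (exists w : wterm i, wterm_eval w = y) -> exists w : wterm i, wterm_eval w = r *: x + y.
Proof. by move=> [w <-] [w' <-]; exists (wlin r w w'). Qed.
Fact hull_d i (x : X (i + 1)) : (exists w : wterm (i + 1), wterm_eval w = x) ->
  exists w : wterm i, wterm_eval w = seq_d X i x.
Proof. by move=> [w <-]; exists (wdif w). Qed.

Definition hull : subcx X :=
  @Subcx R X (fun i => Submod (hull0 i) (@hull_lin i)) hull_d.

Lemma hull_term (s : forall k, V k -> X k) :
  (forall k v, hull k (s k v)) -> forall k (u : term R V k), hull k (term_eval s u).
Proof.
move=> h k; elim=> {k} [k v|k|k r u IH u' IH'|k u IH].
- exact: h.
- exact: (smem0 (hull k)).
- exact: (@smem_lin _ _ (hull k)).
- exact: (@skd _ _ hull).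
Qed.

(** The system that a family s solves, with its values in the hull prescribed, was
given a solution in the hull when the hull was generated. *)
Lemma hull_locally_retracts : locally_retracts V psi hull.
Proof.
move=> s; pose inD k (u : term R V k) : Prop := hull k (term_eval s u).
have E k (u : term R V k) : exists w : wterm k, inD k u -> wterm_eval w = term_eval s u.
  have [[w hw]|n] := pselect (inD k u); first by exists w.
  by exists (wzero k).
have [ch' hch] := dep_choice (fun k => dep_choice (E k)).
pose ch k u := ch' k u; pose pv u := psi (term_eval s u).
pose t k u := wterm_eval (ch k u).
have /solutionP [h1 h2] : exists s, solves inD pv t s.
  by exists s; split=> // k u hu; rewrite /t hch.
exists (solution inD pv t); split=> [|k u hu|u]; last exact: h2.
  apply: hull_term => k v; by exists (wnode v inD pv ch).
by rewrite h1 // /t hch.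
Qed.
End W.

Definition nats (_ : int) : Type := nat.
Lemma has_nats_nats : has_nats nats.
Proof. by move=> k; exists id, id. Qed.

Definition wnat c T i (w : wterm nats c T i) : nat :=
  match w with wbase _ n => n | _ => 0%N end.
Lemma has_nats_wterm c T : has_nats (wterm nats c T).
Proof. by move=> k; exists (@wnat c T k), (fun n => @wbase nats c T k n). Qed.

(** The first level bounds the small pure subcomplexes; the second one bounds the
subcomplexes that have local retractions with respect to all subcomplexes of
first-level size. *)
Definition small_index (c : int) (T : Type) : int -> Type :=
  wterm (wterm nats c T) c T.

Lemma sub_swap (U : zmodType) (p q p' q' : U) : - p' + q' = - p + q -> p - p' = q - q'.
Proof. by move=> e; rewrite -[in LHS](addrK q' (- p')) e !addrA subrr add0r. Qed.

(** The hull D of second-level size is all of X.  Otherwise X / D contains a hull J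
of first-level size that is not 0.  A family s of lifts of the elements of J has
a retraction s' into D, and j |-> s j - s' j embeds J into ker psi.  Followed by
X -> X / D it is the inclusion of J, so it is pure, against the minimality
of X. *)
Lemma small_of_minimal (X : cx) c (M : lmodType R) (psi : {linear X c -> M}) :
  acflat X ->
  (forall K : subcx X, (forall x, K c x -> psi x = 0) -> acflat (qcx K) ->
     forall i x, K i x -> x = 0) ->
  exists e : forall i, small_index c M i -> X i, forall i x, exists w, e i w = x.
Proof.
move=> gX hmin.
pose W1 := wterm nats c M.
pose D := hull psi (fun k (_ : W1 k) => 0 : X k).
have rD : locally_retracts W1 psi D by apply: hull_locally_retracts.
have gZ : acflat (qcx D) by apply: (locally_retracts_good (@has_nats_wterm c M) rD).
exists (@wterm_eval W1 c M X psi (fun k _ => 0)) => i x; apply: contrapT => hx.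
set Z := qcx D in gZ; pose pi := qcpi D.
pose J := hull (fun _ : Z c => 0 : M) (fun k (_ : nat) => dinj_fun (X := fun k => Z k) (pi i x) k).
have rJ : locally_retracts nats (fun _ : Z c => 0 : M) J by apply: hull_locally_retracts.
have xJ : J i (pi i x).
  by exists (wbase c M (V := nats) (i := i) 0%N); rewrite /= dinj_funE.
have E k (w : W1 k) : exists y : X k, pi k y =
    wterm_eval (fun _ : Z c => 0 : M) (fun k (_ : nats k) => dinj_fun (X := fun k => Z k) (pi i x) k) w.
  exact: qpi_surj.
have [s0 hs0] := dep_choice (fun k => dep_choice (E k)).
pose s k w := s0 k w.
have hs k w : pi k (s k w) = wterm_eval _ _ w := hs0 k w.
have [s' [r1 r2 r3]] := rD s.
have piD k (u : term R W1 k) : pi k (term_eval s' u) = 0 by apply/qpi0/r1.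
have fixed k (u : term R W1 k) : pi k (term_eval s u) = 0 -> term_eval s' u = term_eval s u.
  by move=> /qpi0P /r2.
have E2 k (j : scx J k) : exists w : W1 k, pi k (s k w) = sincl (J k) j.
  by have [w hw] := sinclP j; exists w; rewrite hs.
have [om0 hom0] := dep_choice (fun k => dep_choice (E2 k)).
pose om k j := om0 k j; have hom k j : pi k (s k (om k j)) = sincl (J k) j := hom0 k j.
(* The copy of J in X: the element j of J is the class of s (om j). *)
pose io k (j : scx J k) := s k (om k j) - s' k (om k j).
have io_lin k : linear (io k).
  move=> a j j'; pose u : term R W1 k := tlin (-1) (tvar (om k (a *: j + j'))) (tlin a (tvar (om k j)) (tvar (om k j'))).
  have := fixed k u; rewrite /= !linearP !hom linearP scaleN1r addNr => /(_ erefl).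
  rewrite !scaleN1r /io => e.
  by rewrite (sub_swap e) scalerBr opprD addrACA.
pose iol k : {linear scx J k -> X k} := mklin (io_lin k).
have io_d k (j : scx J (k + 1)) : iol k (seq_d (scx J) k j) = seq_d X k (iol (k + 1) j).
  rewrite !mklinE /io linearB.
  pose u : term R W1 k := tlin (-1) (tvar (om k (seq_d (scx J) k j))) (tdif (tvar (om (k + 1) j))).
  have e : pi k (-1 *: s k (om k (seq_d (scx J) k j)) + seq_d X k (s (k + 1) (om (k + 1) j))) = 0.
    by rewrite linearP cmd !hom sdE scaleN1r addNr.
  have {}e : -1 *: s' k (om k (seq_d (scx J) k j)) + seq_d X k (s' (k + 1) (om (k + 1) j)) =
    -1 *: s k (om k (seq_d (scx J) k j)) + seq_d X k (s (k + 1) (om (k + 1) j)) := fixed k u e.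
  by rewrite !scaleN1r in e; apply: sub_swap.
pose ioc : cmap (scx J) X := @CMap R (scx J) X iol io_d.
have piio k j : pi k (ioc k j) = sincl (J k) j.
  rewrite (mklinE (io_lin k)) linearB hom (_ : pi k (s' k _) = 0) ?subr0 //.
  exact: (piD k (tvar _)).
pose K : subcx X := imgcx ioc.
have pu (B : lmodType R^c) k : injective (tensor_map (idl B) (ioc k)).
  apply: inj0P => t ht; apply: (locally_retracts_pure has_nats_nats rJ (B := B) (i := k)).
  rewrite tmap0 -(tmap_comp (g := idl B) (f := ioc k) (g' := idl B) (f' := pi k)) //.
  by have -> : tensor_map (idl B) (ioc k) t = 0 by []; rewrite tmap0.
have gK : acflat (qcx K).
  apply: (acflat_pure (io := ioc)) => // A hA.
  by apply: (locally_retracts_exact has_nats_nats rJ); apply: gZ.2.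
have kK y : K c y -> psi y = 0.
  move=> [j <-]; rewrite (mklinE (io_lin c)) linearB; apply/eqP; rewrite subr_eq0; apply/eqP.
  by rewrite -(r3 (tvar (om c j))).
have [j ej] := sincl_ex xJ.
have e0 : ioc i j = 0 by apply: (hmin K kK gK); exists j.
have := piio i j; rewrite e0 linear0 ej => /esym /qpi0P; exact: hx.
Qed.
End Hull.

(** * A weakly terminal complex over M *)

Section WeakTerminal.
Variables (R : pzRingType) (c : int) (M : lmodType R).
Notation cx := (int_sequence R).

Record over_cx := OverCx {
  ocx :> cx;
  opsi : {linear ocx c -> M};
  opsi_d : forall x, opsi (seq_d ocx c x) = 0;
  ogood : acflat ocx
}.

Definition is_over (X Y : over_cx) (f : cmap X Y) : Prop := forall x, opsi Y (f c x) = opsi X x.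

Definition preimcx (X : cx) (K : subcx X) (L : subcx (qcx K)) : subcx X :=
  kercx (cmap_comp (qcpi L) (qcpi K)).

Lemma preimcxP (X : cx) (K : subcx X) (L : subcx (qcx K)) i x :
  preimcx L i x <-> L i (qcpi K i x).
Proof. exact: qpi0P. Qed.

Lemma acflat_quot_ker (X Y : cx) (f : cmap X Y) (K : subcx X) :
  (forall i, surj (f i)) -> (forall i x, K i x <-> f i x = 0) ->
  acflat Y -> acflat (qcx K).
Proof.
move=> sf hK gY.
have [g hg] : exists g : cmap (qcx K) Y, forall i x, g i (qpi (K i) x) = f i x.
  by apply: qcx_lift => i x /hK.
have E i (y : Y i) : exists q : qcx K i, g i q = y.
  by have [x <-] := sf i y; exists (qpi (K i) x).
have gi i : injective (g i).
  by apply: linj => q; have [x <-] := qpi_surj q; rewrite hg => /hK /qpi0P.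
have [h0 hh] := dep_choice (fun i => dep_choice (E i)).
pose h i y := h0 i y; have gh i y : g i (h i y) = y := hh i y.
have hl i : linear (h i) by move=> a x y; apply: gi; rewrite linearP !gh.
have hd i y : mklin (hl i) (seq_d Y i y) = seq_d (qcx K) i (mklin (hl (i + 1)) y).
  by rewrite !(mklinE (hl _)); apply: gi; rewrite gh cmd gh.
apply: (@acflat_retract R (qcx K) Y g (@CMap R Y (qcx K) _ hd)) => // i q.
by apply: gi; rewrite (mklinE (hl _)) gh.
Qed.

Lemma acflat_preim (X : cx) (K : subcx X) (L : subcx (qcx K)) :
  acflat (qcx L) -> acflat (qcx (preimcx L)).
Proof.
move=> gL; apply: (acflat_quot_ker (f := cmap_comp (qcpi L) (qcpi K))) => //.
move=> i q; have [p <-] := qpi_surj q; have [x <-] := qpi_surj p.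
by exists x.
Qed.

(** The labels D play no part in the closure of the class under chains; they let
invariants of K be indexed by a set that grows with K. *)
Lemma zorn_quot (X : cx) (L : Type) (P : (L -> Prop) -> subcx X -> Prop)
  (D0 : L -> Prop) (K0 : subcx X) :
  P D0 K0 -> acflat (qcx K0) ->
  (forall (J : Type) (D : J -> L -> Prop) (K : J -> subcx X) (U : subcx X),
     inhabited J ->
     (forall j k : J, ((forall l, D j l -> D k l) /\ (forall i x, K j i x -> K k i x)) \/
        ((forall l, D k l -> D j l) /\ (forall i x, K k i x -> K j i x))) ->
     (forall i x, U i x <-> exists j, K j i x) ->
     (forall j, P (D j) (K j)) -> P (fun l => exists j, D j l) U) ->
  exists D K, [/\ P D K, acflat (qcx K) &
    forall D' K', P D' K' -> acflat (qcx K') -> (forall l, D l -> D' l) ->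
      (forall i x, K i x -> K' i x) ->
      (forall l, D' l -> D l) /\ (forall i x, K' i x -> K i x)].
Proof.
move=> PZ gZ hP.
pose S := {p : (L -> Prop) * subcx X | P p.1 p.2 /\ acflat (qcx p.2)}.
pose lep (p q : (L -> Prop) * subcx X) :=
  (forall l, p.1 l -> q.1 l) /\ (forall i x, p.2 i x -> q.2 i x).
pose le (p q : S) := `[< lep (proj1_sig p) (proj1_sig q) >].
pose z0 : S := exist _ (D0, K0) (conj PZ gZ).
have [||A tA|[[D K] [PK gK]] Kmax] := @ZL_preorder S z0 le.
- by move=> p; apply/asboolP.
- move=> p q r /asboolP [h1 h2] /asboolP [h3 h4]; apply/asboolP; split=> [l|i x].
    by move=> /h1 /h3.
  by move=> /h2 /h4.
- have [[p0 Ap0]|nA] := pselect (exists p, A p); last first.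
    by exists z0 => p Ap; case: nA; exists p.
  pose J := {p | A p}.
  pose DJ (j : J) := (proj1_sig (proj1_sig j)).1.
  pose KJ (j : J) := (proj1_sig (proj1_sig j)).2.
  have tot (j k : J) : ((forall l, DJ j l -> DJ k l) /\ (forall i x, KJ j i x -> KJ k i x)) \/
        ((forall l, DJ k l -> DJ j l) /\ (forall i x, KJ k i x -> KJ j i x)).
    case: j k => [j Aj] [k Ak]; rewrite /KJ /DJ /=.
    by have [/asboolP h|/asboolP h] := tA _ _ Aj Ak; [left|right].
  have U0 i : exists j, KJ j i 0 by exists (exist _ p0 Ap0); apply: smem0.
  have Ul i (a : R) x y : (exists j, KJ j i x) -> (exists j, KJ j i y) -> exists j, KJ j i (a *: x + y).
    move=> [j hj] [k hk]; have [[_ h]|[_ h]] := tot j k; [exists k|exists j]; apply: smem_lin => //; exact: h.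
  have Ud i x : (exists j, KJ j (i + 1) x) -> exists j, KJ j i (seq_d X i x).
    by move=> [j hj]; exists j; apply: skd.
  pose U : subcx X := @Subcx R X (fun i => Submod (U0 i) (Ul i)) Ud.
  have iJ : inhabited J by exists; exists p0.
  have PU : P (fun l => exists j, DJ j l) U.
    apply: (hP J DJ KJ) => // j; exact: (proj1 (proj2_sig (proj1_sig j))).
  have gU : acflat (qcx U).
    apply: (acflat_chain (K := KJ)) => // [j k|j].
      by have [[_ h]|[_ h]] := tot j k; [left|right].
    exact: (proj2 (proj2_sig (proj1_sig j))).
  exists (exist _ (_, U) (conj PU gU)) => p Ap; apply/asboolP; split=> [l|i x] h.
    by exists (exist _ p Ap).
  by exists (exist _ p Ap).
exists D, K; split=> // D' K' PK' gK' h1 h2.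
have /Kmax /asboolP : le (exist _ (D, K) (conj PK gK)) (exist _ (D', K') (conj PK' gK')).
  by apply/asboolP.
by [].
Qed.

Lemma acflat_zero (X : cx) : acflat X -> acflat (qcx (kercx (cmap_id X))).
Proof.
by apply: (acflat_quot_ker (f := cmap_id X)) => // i x; exists x.
Qed.

Section OvQuot.
Variables (X : over_cx) (K : subcx X).
Hypotheses (kK : forall x, K c x -> opsi X x = 0) (gK : acflat (qcx K)).

Fact ovq_ex : exists psi : {linear quot (K c) -> M}, forall x, psi (qpi (K c) x) = opsi X x.
Proof. by apply: surj_factor; [exact: qpi_surj|move=> x /qpi0P; apply: kK]. Qed.
Definition ovq_psi := projT1 (cid ovq_ex).
Fact ovq_psiE x : ovq_psi (qpi (K c) x) = opsi X x.
Proof. exact: (projT2 (cid ovq_ex)). Qed.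
Fact ovq_d (q : qcx K (c + 1)) : ovq_psi (seq_d (qcx K) c q) = 0.
Proof. by have [x <-] := qpi_surj q; rewrite qdE ovq_psiE opsi_d. Qed.
Definition ovq : over_cx := @OverCx (qcx K) ovq_psi ovq_d gK.
Lemma ovqE x : opsi ovq (qcpi K c x) = opsi X x. Proof. exact: ovq_psiE. Qed.
End OvQuot.

(** The preimage of a subcomplex of X / K with quotient in the class has the same
quotient as that subcomplex; hence a maximal K leaves nothing more to divide
out. *)
Lemma minimal_quotient (X : over_cx) : exists (Y : over_cx) (f : cmap X Y), is_over f /\
  (forall K : subcx Y, (forall x, K c x -> opsi Y x = 0) -> acflat (qcx K) ->
     forall i x, K i x -> x = 0).
Proof.
have [|||D [K [kK gK Kmax]]] := @zorn_quot X unit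
   (fun _ K => forall x, K c x -> opsi X x = 0) (fun _ => True) (kercx (cmap_id X)).
- by move=> x /= ->; rewrite linear0.
- exact/acflat_zero/ogood.
- by move=> J _ KJ U _ _ hU h x /hU [j]; apply: h.
exists (ovq kK gK), (qcpi K); split=> [x|L kL gL i q hq]; first exact: ovqE.
have kL' x : preimcx L c x -> opsi X x = 0 by move=> /preimcxP /kL; rewrite ovqE.
have [//||_ h] := Kmax (fun _ => True) _ kL' (acflat_preim gL).
  move=> k x /= hx; apply/preimcxP; rewrite (_ : qcpi K k x = 0); first exact: smem0.
  exact/qpi0P.
have [x ex] := qpi_surj q; rewrite -ex; apply/qpi0P/(h i x)/preimcxP.
by rewrite /= ex.
Qed.

(** Every complex bounded by [small_index] is, degree by degree, a quotient of
these free modules, so that such complexes form a set up to isomorphism. *)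
Definition sgens (i : int) : lmodType R :=
  dsum (fun _ : {classic small_index R c M i} => (R^o : lmodType R)).

Record smallov := SmallOv {
  so_K : forall i, submod (sgens i);
  so_d : forall i, {linear quot (so_K (i + 1)) -> quot (so_K i)};
  so_psi : {linear quot (so_K c) -> M};
  so_psid : forall x, so_psi (so_d c x) = 0;
  so_good : acflat (IntSequence so_d)
}.

Definition ov_of_small (X : smallov) : over_cx := @OverCx (IntSequence (@so_d X)) (so_psi X) (@so_psid X) (so_good X).

Lemma dsov_ex (I : choiceType) (X : I -> over_cx) : exists psi : {linear dscx X c -> M},
  (forall k x, psi (dinj (X := fun k => X k c) k x) = opsi (X k) x) /\
  forall x, psi (seq_d (dscx X) c x) = 0.
Proof.
have [psi hpsi] := dsum_lift (fun k => opsi (X k)).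
exists psi; split=> // x; elim/dsum_ind: x => [|k x f IH]; first by rewrite !linear0.
by rewrite !linearD IH dsdE hpsi opsi_d addr0.
Qed.

Definition dsov (I : choiceType) (X : I -> over_cx) : over_cx :=
  @OverCx (dscx X) (projT1 (cid (dsov_ex X))) (proj2 (projT2 (cid (dsov_ex X))))
    (acflat_dscx (fun k => ogood (X k))).

Lemma dsov_psi (I : choiceType) (X : I -> over_cx) k x :
  opsi (dsov X) (dinj (X := fun k => X k c) k x) = opsi (X k) x.
Proof. exact: (proj1 (projT2 (cid (dsov_ex X)))). Qed.

Lemma weak_terminal : exists C : over_cx, forall X : over_cx, exists f : cmap X C, is_over f.
Proof.
exists (@dsov {classic smallov} ov_of_small) => X.
have [Y [f [of_ hY]]] := minimal_quotient X.
have [e he] := small_of_minimal (ogood Y) hY.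
have E i : exists g : {linear sgens i -> Y i}, forall w r, g (dinj w r) = (r : R) *: e i w.
  have l w : linear (fun r : R^o => (r : R) *: e i w).
    by move=> a r r'; rewrite scalerDl -scalerA.
  by have [g hg] := @dsum_lift R {classic small_index R c M i} (fun _ => R^o) _ (fun w => mklin (l w)); exists g => w r; rewrite hg (mklinE (l w)).
have [g hg] := dep_choice E.
have sg i : surj (g i).
  move=> y; have [w <-] := he i y; exists (dinj (I := {classic small_index R c M i}) (X := fun _ => R^o) w 1).
  by rewrite hg scale1r.
pose K i := kerm (g i).
have E2 i : exists a : {linear quot (K i) -> Y i}, forall x, a (qpi (K i) x) = g i x.
  by apply: surj_factor; [exact: qpi_surj|move=> x /qpi0P].
have [a ha] := dep_choice E2.
have E3 i : exists b : {linear Y i -> quot (K i)}, forall x, b (g i x) = qpi (K i) x.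
  by apply: surj_factor => // x hx; apply/qpi0.
have [b hb] := dep_choice E3.
have ab i y : a i (b i y) = y by have [x <-] := sg i y; rewrite hb ha.
have ba i q : b i (a i q) = q by have [x <-] := qpi_surj q; rewrite ha hb.
pose d i : {linear quot (K (i + 1)) -> quot (K i)} := b i \o seq_d Y i \o a (i + 1).
pose Z : cx := IntSequence d.
have ad i (q : Z (i + 1)) : a i (seq_d Z i q) = seq_d Y i (a (i + 1) q) by rewrite /= ab.
have bd i (y : Y (i + 1)) : b i (seq_d Y i y) = seq_d Z i (b (i + 1) y) by rewrite /= ab.
have gZ : acflat Z.
  apply: (@acflat_retract R Z Y (@CMap R Z Y a ad) (@CMap R Y Z b bd)) => //; exact: ogood.
pose psi : {linear quot (K c) -> M} := opsi Y \o a c.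
have psid q : psi (d c q) = 0 by rewrite /= ab opsi_d.
pose S := @SmallOv K d psi psid gZ.
pose bc : cmap Y (ov_of_small S) := @CMap R Y (ov_of_small S) b bd.
exists (cmap_comp (dcinj (I := {classic smallov}) ov_of_small S) (cmap_comp bc f)) => x.
apply: (etrans (@dsov_psi {classic smallov} ov_of_small S (b c (f c x)))).
by rewrite /= ab of_.
Qed.
End WeakTerminal.

(** * From a weakly terminal object to a cover *)

Section Enochs.
Variables (R : pzRingType) (c : int) (M : lmodType R).
Notation cx := (int_sequence R).
Notation over_cx := (over_cx c M).

Definition weakly_terminal (C : over_cx) : Prop := forall X : over_cx, exists f : cmap X C, is_over f.

Section Step.
Variables (J : choiceType) (C : over_cx).
Notation T := (dsov (fun _ : J => C)).
Notation din k := (dinj (X := fun _ : J => ocx C _) k).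

Fact zero_d (X Y : cx) i (x : X (i + 1)) :
  (\0 : {linear X i -> Y i}) (seq_d X i x) = seq_d Y i ((\0 : {linear X (i + 1) -> Y (i + 1)}) x).
Proof. by rewrite /= linear0. Qed.
Definition cmap0 (X Y : cx) : cmap X Y := CMap (cmf := fun i => \0) (@zero_d X Y).

Fact restr_ex (D : J -> Prop) : exists r : cmap T T, forall i k (x : C i),
  r i (din k x) = if pselect (D k) then din k x else 0.
Proof.
have [r hr] := dscx_lift (fun k => if pselect (D k) then dcinj (fun _ : J => ocx C) k else cmap0 C T).
by exists r => i k x; rewrite hr; case: pselect.
Qed.
Definition restr D : cmap T T := projT1 (cid (restr_ex D)).
Lemma restr_din D i k (x : C i) : restr D i (din k x) = if pselect (D k) then din k x else 0.
Proof. exact: (projT2 (cid (restr_ex D)) i k x). Qed.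

Lemma restr_dinT (D : J -> Prop) i k (x : C i) : D k -> restr D i (din k x) = din k x.
Proof. by move=> Dk; rewrite restr_din; case: pselect. Qed.
Lemma restr_dinF (D : J -> Prop) i k (x : C i) : ~ D k -> restr D i (din k x) = 0.
Proof. by move=> Dk; rewrite restr_din; case: pselect. Qed.

Lemma restr_in D i (t : T i) k : D k -> restr D i t k = t k.
Proof.
move=> Dk; elim/dsum_ind: t => [|j x t IH]; first by rewrite linear0.
rewrite linearD -!dprojE !linearD !dprojE IH restr_din; congr (_ + _).
case: pselect => // nD; rewrite dinj0 //; by apply: contra_notN nD => /eqP ->.
Qed.
Lemma restr_out D i (t : T i) k : ~ D k -> restr D i t k = 0.
Proof.
move=> nD; elim/dsum_ind: t => [|j x t IH]; first by rewrite linear0.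
rewrite linearD -!dprojE linearD !dprojE IH restr_din addr0.
case: pselect => // Dj; rewrite dinj0 //; by apply: contra_notN nD => /eqP <-.
Qed.
Definition supp (D : J -> Prop) i (t : T i) := forall k, ~ D k -> t k = 0.
Lemma restr_supp D i (t : T i) : supp D t -> restr D i t = t.
Proof.
move=> h; apply: dsum_eq => k; have [Dk|nD] := pselect (D k); first exact: restr_in.
by rewrite restr_out // h.
Qed.
Lemma supp_restr D i (t : T i) : supp D (restr D i t).
Proof. by move=> k; apply: restr_out. Qed.
Lemma supp_din (D : J -> Prop) i k (x : C i) : D k -> supp D (din k x).
Proof. by move=> Dk j nD; rewrite dinj0 //; apply: contra_notN nD => /eqP <-. Qed.

(** The copies of C with label in D are mapped by g to a new copy, with label x, and
identified with their images there, while the other copies stay free.  The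
quotient is a retract of the direct sum, because K is the kernel of the idempotent
Ph that performs this identification. *)
Lemma glue (D : J -> Prop) (x : J) (g : cmap T C) :
  ~ D x -> (forall k y, D k -> opsi C (g c (din k y)) = opsi C y) ->
  exists K : subcx T, [/\ acflat (qcx K), forall t, K c t -> opsi T t = 0 &
    forall i t, K i t <-> ((forall k, ~ D k -> k <> x -> t k = 0) /\ t x + g i (restr D i t) = 0)].
Proof.
move=> nx og.
have [Ph hPh] := dscx_lift (fun k => if pselect (D k)
  then cmap_comp (dcinj (fun _ : J => ocx C) x) (cmap_comp g (dcinj (fun _ : J => ocx C) k))
  else dcinj (fun _ : J => ocx C) k).
have PhD i k y : D k -> Ph i (din k y) = din x (g i (din k y)).
  by move=> Dk; rewrite hPh; case: pselect.
have PhN i k y : ~ D k -> Ph i (din k y) = din k y.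
  by move=> Dk; rewrite hPh; case: pselect.
have idem i t : Ph i (Ph i t) = Ph i t.
  elim/dsum_ind: t => [|k y t IH]; first by rewrite !linear0.
  rewrite !linearD IH; have [Dk|nD] := pselect (D k); last by rewrite !PhN.
  by rewrite PhD // PhN.
have psiPh t : opsi T (Ph c t) = opsi T t.
  elim/dsum_ind: t => [|k y t IH]; first by rewrite !linear0.
  rewrite !linearD IH; have [Dk|nD] := pselect (D k); last by rewrite PhN.
  by rewrite PhD // !dsov_psi og.
have comp i t : [/\ forall k, D k -> Ph i t k = 0, Ph i t x = t x + g i (restr D i t) &
    forall k, ~ D k -> k <> x -> Ph i t k = t k].
  elim/dsum_ind: t => [|k y t [h1 h2 h3]].
    by rewrite !linear0; split=> //; rewrite addr0.
  have E j : Ph i (din k y + t) j = Ph i (din k y) j + Ph i t j by rewrite linearD.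
  have E' j : (din k y + t) j = din k y j + t j by [].
  have [Dk|nD] := pselect (D k); split.
  - move=> j Dj; rewrite E PhD // h1 // addr0 dinj0 //.
    by apply: contra_notN nx => /eqP ->.
  - rewrite E E' PhD // h2 dinjE !linearD restr_dinT //.
    rewrite [din k y x]dinj0 ?add0r; first by rewrite addrCA.
    by apply: contra_notN nx => /eqP <-.
  - move=> j nj jx; rewrite E E' PhD // h3 // !dinj0 //.
      by apply: contra_notN nj => /eqP <-.
    by apply/eqP => e; apply: jx.
  - move=> j Dj; rewrite E PhN // h1 // addr0 dinj0 //.
    by apply: contra_notN nD => /eqP ->.
  - rewrite E E' PhN // h2 !linearD restr_dinF //.
    by rewrite linear0 add0r addrA.
  - by move=> j nj jx; rewrite E E' PhN // h3.
exists (kercx Ph); split.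
- have [a ha] : exists a : cmap (qcx (kercx Ph)) T, forall i t, a i (qpi (kercx Ph i) t) = Ph i t.
    by apply: qcx_lift.
  apply: (@acflat_retract R _ T a (qcpi (kercx Ph))); last exact: ogood.
  move=> i q; have [t <-] := qpi_surj q; rewrite ha; apply/qpiP => /=.
  by rewrite linearB idem subrr.
- by move=> t /= h; rewrite -psiPh h linear0.
- move=> i t; have [h1 h2 h3] := comp i t; split=> [h|[h4 h5]].
    split=> [k nD kx|]; first by rewrite -h3 // h.
    by rewrite -h2 h.
  apply: dsum_eq => k; have [Dk|nD] := pselect (D k); first exact: h1.
  have [->|kx] := pselect (k = x); first by rewrite h2 h5.
  by rewrite h3 // h4.
Qed.
End Step.
Notation din k := (dinj (X := fun _ => ocx _ _) k).

Section Inj.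
Variable C : over_cx.
Hypothesis wt : weakly_terminal C.

(** The label [lnew i l] is reserved for killing the element of the direct sum of
copies of C that the list l represents, so that no label is used twice and a
fresh label is always available. *)
Inductive label := lbase | lnew (i : int) (l : seq (label * C i)).
Notation J := {classic label}.
Notation T := (dsov (fun _ : J => C)).

Definition lab_in (K : subcx T) (k : label) : Prop :=
  match k with
  | lbase => True
  | lnew i l => K i (\sum_(p <- l) dinj (I := J) (X := fun _ => C i) p.1 p.2)
  end.

(** Q is the part of a maximal quotient T / K that is generated by the copies with
label in D.  If a map from Q to C over M killed the class of u, then gluing a new
copy of C along it, with the label of u, would enlarge K by u. *)
Lemma weakly_terminal_inj : exists Q : over_cx, weakly_terminal Q /\
  forall (X : over_cx) (f : cmap Q X), is_over f -> forall i, injective (f i).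
Proof.
pose P (D : J -> Prop) (K : subcx T) := [/\ forall i t, K i t -> supp D t,
  forall t, K c t -> opsi T t = 0, D lbase & forall k, D k -> lab_in K k].
have mono (K K' : subcx T) k : (forall i t, K i t -> K' i t) -> lab_in K k -> lab_in K' k.
  by move=> h; case: k => //= i l; apply: h.
have [|||D [K [[K1 K2 K3 K4] gK Kmax]]] :=
  @zorn_quot R T J P (fun k => k = lbase) (kercx (cmap_id T)).
- split=> //; first by move=> i t /= ->.
    by move=> t /= ->; rewrite linear0.
  by move=> k ->.
- exact/acflat_zero/ogood.
- move=> A DA KA U [a0] tot hU hP; split.
  + move=> i t /hU [a ha] k nD; have [h1 _ _ _] := hP a; apply: (h1 i t ha).
    by move=> Da; apply: nD; exists a.
  + by move=> t /hU [a ha]; have [_ h2 _ _] := hP a; apply: h2.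
  + by exists a0; have [_ _ h3 _] := hP a0.
  + move=> k [a ha]; have [_ _ _ h4] := hP a; apply: mono (h4 _ ha) => i t ht.
    by apply/hU; exists a.
pose r := restr C D.
(* T / Kh is T / K without the free copies of C, those with label outside D. *)
pose Kh := kercx (cmap_comp (qcpi K) r).
have KhP i t : Kh i t <-> K i (r i t) by apply: qpi0P.
have kKh t : Kh c t -> opsi T (r c t) = 0 by move=> /KhP /K2.
have gKh : acflat (qcx Kh).
  have [a ha] : exists a : cmap (qcx Kh) (qcx K), forall i t, a i (qpi (Kh i) t) = cmap_comp (qcpi K) r i t.
    by apply: qcx_lift.
  have [b hb] : exists b : cmap (qcx K) (qcx Kh), forall i t, b i (qpi (K i) t) = qcpi Kh i t.
    apply: qcx_lift => i t ht; apply/qpi0P/KhP.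
    by rewrite /r restr_supp //; apply: K1.
  apply: (acflat_retract (a := a) (b := b)) => // i q.
  have [t <-] := qpi_surj q; rewrite ha hb; apply/qpiP/KhP.
  by rewrite linearB /r (restr_supp (@supp_restr _ _ _ _ _)) subrr; apply: smem0.
have [psi hpsi] : exists psi : {linear quot (Kh c) -> M}, forall x, psi (qpi (Kh c) x) = opsi T (r c x).
  apply: (surj_factor (f := opsi T \o r c)); first exact: qpi_surj.
  by move=> x /qpi0P; apply: kKh.
have psid (q : qcx Kh (c + 1)) : psi (seq_d (qcx Kh) c q) = 0.
  by have [x <-] := qpi_surj q; rewrite qdE hpsi cmd opsi_d.
pose Q : over_cx := @OverCx R c M (qcx Kh) psi psid gKh.
have qr i t : qcpi Kh i (r i t) = qcpi Kh i t.
  apply/qpiP/KhP; rewrite linearB /r (restr_supp (@supp_restr _ _ _ _ _)) subrr; exact: smem0.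
exists Q; split=> [X|X f of_ i].
  have [h oh] := wt X.
  exists (cmap_comp (qcpi Kh) (cmap_comp (dcinj (fun _ : J => ocx C) lbase) h)) => x.
  rewrite /= hpsi /r restr_supp; last exact: supp_din.
  by rewrite dsov_psi oh.
have [h oh] := wt X.
suff: injective (cmap_comp h f i) by move=> inj q q' e; apply: inj; rewrite /= e.
apply: linj => q; have [t <-] := qpi_surj q => h0.
apply/qpi0P/KhP; set u := r i t.
have su : supp D u by apply: supp_restr.
have [s [us hs]] := dsum_supp u.
pose l := [seq (k : label, u k) | k <- s].
have el : \sum_(p <- l) dinj (I := J) (X := fun _ => C i) p.1 p.2 = u.
  by rewrite big_map /= -dsum_decomp.
pose x : J := lnew l.
have labE (L : subcx T) : lab_in L x = L i u by rewrite /x /lab_in el.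
have [Dx|nx] := pselect (D x); first by have := K4 x Dx; rewrite labE.
pose g := cmap_comp (cmap_comp h f) (qcpi Kh).
have og k y : D k -> opsi C (g c (dinj (X := fun _ => ocx C c) k y)) = opsi C y.
  move=> Dk; rewrite /= oh of_ /= hpsi /r restr_supp; last exact: supp_din.
  by rewrite dsov_psi.
have gu : g i u = 0 by rewrite /= qr.
have [K' [gK' K'psi K'P]] := glue nx og.
pose D' k := D k \/ k = x.
have KK' j v : K j v -> K' j v.
  move=> hv; have sv := K1 j v hv; apply/K'P; split=> [k nD _|]; first exact: sv.
  rewrite sv // add0r restr_supp //=.
  rewrite (_ : qpi (Kh j) v = 0) ?linear0 //; apply/qpi0P/KhP.
  by rewrite /r restr_supp.
have PD' : P D' K'.
  split=> //; last first.
    move=> k [Dk|->]; first exact: mono (K4 k Dk).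
    rewrite labE; apply/K'P; split=> [k' nD _|]; first exact: su.
    by rewrite su // add0r restr_supp.
  - by left.
  - move=> j v /K'P [h1 _] k nD'; apply: h1 => e; apply: nD'; [by left|by right].
have [hD _] := Kmax D' K' PD' gK' (fun k => @or_introl _ _) KK'.
by case: nx; apply: hD; right.
Qed.
End Inj.

Lemma cantor (A : Type) (f : (A -> Prop) -> A) : injective f -> False.
Proof.
move=> fi; pose S a := exists P, f P = a /\ ~ P a.
have nS : ~ S (f S) by move=> hS; case: (hS) => P [/fi e]; apply; rewrite e.
by apply: (nS); exists S.
Qed.

Section Surj.
Variable C : over_cx.
Hypothesis wt : weakly_terminal C.
Hypothesis inj : forall (X : over_cx) (f : cmap C X), is_over f -> forall i, injective (f i).

(** If g misses y, copies of C are glued along g, each containing all earlier ones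
as a proper part that misses its own copy of y.  The union of a maximal such chain
embeds into C, so the copies of y show that there are at most as many labels as
elements of C i; since labels are subsets of C i, some label is left to continue
the chain. *)
Lemma endo_surj (g : cmap C C) : is_over g -> forall i (y : C i), exists x, g i x = y.
Proof.
move=> og i y; apply: contrapT => ny.
pose J := {classic (C i -> Prop)}.
pose T := dsov (fun _ : J => C).
pose dn k j := dinj (I := J) (X := fun _ => ocx C j) k.
pose P (D : J -> Prop) (K : subcx T) := [/\ forall j t, K j t -> supp D t,
  forall t, K c t -> opsi T t = 0,
  forall j (t : T j), supp D t -> exists k z, D k /\ K j (t - dn k j z) &
  forall k k', D k -> D k' -> K i (dn k i y - dn k' i y) -> k = k'].
pose k0 : J := fun _ => True.
have [|||D [K [[K1 K2 K3 K4] gK Kmax]]] :=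
  @zorn_quot R T J P (fun k => k = k0) (kercx (cmap_id T)).
- split=> //; first by move=> j t /= ->.
  + by move=> t /= ->; rewrite linear0.
  + move=> j t st; exists k0, (t k0); split=> //=; apply/eqP; rewrite subr_eq0; apply/eqP.
    apply: dsum_eq => k; have [->|nk] := pselect (k = k0); first by rewrite dinjE.
    by rewrite st // dinj0 //; apply/eqP => e; apply: nk.
  + by move=> k k' -> ->.
- exact/acflat_zero/ogood.
- move=> A DA KA U [a0] tot hU hP; split.
  + move=> j t /hU [a ha] k nD; have [h1 _ _ _] := hP a; apply: (h1 j t ha).
    by move=> Da; apply: nD; exists a.
  + by move=> t /hU [a ha]; have [_ h2 _ _] := hP a; apply: h2.
  + move=> j t st.
    have [s [us hs]] := dsum_supp t.
    have [a ha] : exists a, forall k, k \in s -> t k <> 0 -> DA a k.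
      elim: s {us hs} => [|k s [a ha]]; first by exists a0.
      have [tk|tk] := pselect (t k = 0).
        by exists a => k'; rewrite inE => /orP [/eqP -> //|]; apply: ha.
      have [b hb] : exists b, DA b k by apply: contrapT => nD; apply: tk; apply: st.
      have [[h _]|[h _]] := tot a b; [exists b|exists a] => k'; rewrite inE => /orP [/eqP -> _|k's tk'] //.
      * by apply: h; apply: ha.
      * exact: h.
      * exact: ha.
    have sa : supp (DA a) t.
      move=> k nD; apply: contrapT => tk; apply: nD; apply: ha => //.
      by apply: contrapT => /negP /hs.
    have [_ _ h3 _] := hP a; have [k [z [Dk hk]]] := h3 j t sa.
    by exists k, z; split; [exists a|apply/hU; exists a].
  + move=> k k' [a ha] [b hb] /hU [d hd].
    have [e [h1 h2 h3]] : exists e, [/\ DA e k, DA e k' & KA e i (dn k i y - dn k' i y)].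
      have [f [fa fb]] : exists f, DA f k /\ DA f k'.
        by have [[h _]|[h _]] := tot a b; [exists b; split => //; apply: h|exists a; split => //; apply: h].
      by have [[h h']|[h h']] := tot f d; [exists d; split => //; apply: h|exists f; split => //; apply: h'].
    by have [_ _ _ h4] := hP e; apply: h4.
have [h oh] := wt (ovq K2 gK).
pose hh := cmap_comp h (qcpi K).
have ohh t : opsi C (hh c t) = opsi T t by rewrite /= oh; apply: ovqE.
(* The part of T / K with labels in D embeds into C, being a union of copies of C. *)
have hinj j (t : T j) : supp D t -> hh j t = 0 -> K j t.
  move=> st ht; have [k [z [Dk hk]]] := K3 j t st.
  have e : hh j t = hh j (dn k j z).
    apply/eqP; rewrite -subr_eq0 -linearB; apply/eqP.
    by rewrite /= (_ : qpi (K j) _ = 0) ?linear0 //; apply/qpi0P.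
  pose hk1 := cmap_comp hh (dcinj (fun _ : J => ocx C) k).
  have ohk : is_over hk1 by move=> w; rewrite /hk1 /= -/(hh c _) ohh dsov_psi.
  have z0 : z = 0.
    by apply: (inj ohk); rewrite linear0 -[RHS]ht e.
  by rewrite z0 linear0 subr0 in hk.
have [allD|nD] := pselect (forall k, D k).
  apply: (@cantor (C i) (fun k => hh i (dn k i y))) => k k' e.
  apply: K4 => //; apply: hinj; first by move=> k1 /(_ (allD k1)).
  by rewrite linearB e subrr.
have [x nx] : exists x, ~ D x by apply: contrapT => h1; apply: nD => k; apply: contrapT => h2; apply: h1; exists k.
pose gg := cmap_comp g hh.
have ogg k z : D k -> opsi C (gg c (dinj (X := fun _ => ocx C c) k z)) = opsi C z.
  by move=> _; rewrite /= og -/(hh c _) ohh dsov_psi.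
have [K' [gK' K'psi K'P]] := glue nx ogg.
pose D' k := D k \/ k = x.
have gg0 j (t : T j) : supp D t -> gg j t = 0 -> K j t.
  move=> st e; apply: hinj => //; apply: (inj og); by rewrite linear0.
have KK' j v : K j v -> K' j v.
  move=> hv; have sv := K1 j v hv; apply/K'P; split=> [k nk _|]; first exact: sv.
  rewrite sv // add0r restr_supp //=.
  by rewrite (_ : qpi (K j) v = 0) ?linear0 //; apply/qpi0P.
have xD k : D k -> k != x by move=> Dk; apply/eqP => e; apply: nx; rewrite -e.
have no k : D k -> ~ K' i (dn k i y - dn x i y).
  move=> Dk /K'P [_]; rewrite linearB.
  have -> : restr C D i (dn k i y) = dn k i y by apply: restr_supp; apply: supp_din.
  have -> : restr C D i (dn x i y) = 0 by rewrite restr_dinF.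
  have -> : (dn k i y - dn x i y) x = - y.
    by rewrite -dprojE linearB !dprojE dinj0 ?xD // dinjE sub0r.
  rewrite subr0 addrC => /eqP; rewrite subr_eq0 => /eqP e; apply: ny.
  by exists (hh i (dn k i y)).
have PD' : P D' K'.
  split=> //.
  - move=> j v /K'P [h1 _] k nD'; apply: h1 => e; apply: nD'; [by left|by right].
  - move=> j t st; exists x, (t x + gg j (restr C D j t)); split; first by right.
    apply/K'P; split=> [k nk kx|].
      rewrite -dprojE linearB !dprojE dinj0 ?subr0; last by apply/eqP => e; apply: kx.
      by apply: st => -[].
    rewrite linearB -[X in X + _]dprojE linearB !dprojE dinjE restr_dinF //.
    by rewrite subr0 opprD addrA subrr sub0r addNr.
  - move=> k k' [Dk|->] [Dk'|->] // hkk.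
    + apply: K4 => //.
      have sk : supp D (dn k i y - dn k' i y).
        move=> k1 nk1; rewrite -dprojE linearB !dprojE.
        have -> : dn k i y k1 = 0 by apply: (supp_din _ Dk).
        have -> : dn k' i y k1 = 0 by apply: (supp_din _ Dk').
        by rewrite subr0.
      apply: gg0 => //; move/K'P: hkk => [_].
      by rewrite sk // add0r restr_supp.
    + by case: (no k Dk).
    + case: (no k' Dk'); rewrite -opprB; exact: smemN.
have [hD _] := Kmax D' K' PD' gK' (fun k => @or_introl _ _) KK'.
by case: nx; apply: hD; right.
Qed.
End Surj.

Lemma cover_exists : exists C : over_cx, weakly_terminal C /\
  forall g : cmap C C, is_over g -> forall i, injective (g i) /\ surj (g i).
Proof.
have [C0 w0] := @weak_terminal R c M.
have [C [wC iC]] := weakly_terminal_inj w0.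
exists C; split=> // g og i; split; first exact: iC og i.
by move=> y; apply: endo_surj.
Qed.
End Enochs.

(** * Gorenstein AC-flat modules *)

(** Values at nonnegative integers come from steps upwards and values at negative
ones from steps downwards; the casts reconcile i + 1 with the recursion on nat. *)
Lemma int_chain (S : int -> Type) (rho : forall i, S (i + 1) -> S i -> Prop) (s0 : S 0) :
  (forall i s, exists s', rho i s' s) -> (forall i s', exists s, rho i s' s) ->
  exists st : forall i, S i, st 0 = s0 /\ forall i, rho i (st (i + 1)) (st i).
Proof.
move=> hup hdn.
have [up upP] := dep_choice (fun i => dep_choice (hup i)).
have [dn dnP] := dep_choice (fun i => dep_choice (hdn i)).
have eP (n : nat) : (n%:Z + 1 = n.+1%:Z)%R by rewrite -PoszD addn1.
pose Nz (n : nat) : int := if n is m.+1 then Negz m else 0%N.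
have eN (n : nat) : Nz n = Negz n + 1.
  by case: n => [|n] //; rewrite /= !NegzE -[in RHS]addn1 PoszD opprD subrK.
pose a := fix a (n : nat) : S n := if n is m.+1 then eq_rect _ S (up m (a m)) _ (eP m) else s0.
pose b := fix b (n : nat) : S (Nz n) :=
  if n is m.+1 then dn (Negz m) (eq_rect _ S (b m) _ (eN m)) else s0.
pose st (i : int) : S i := match i with Posz n => a n | Negz n => b n.+1 end.
exists st; split=> // i.
have cast j (e : j = i + 1) : rho i (eq_rect _ S (st j) _ e) (st i) -> rho i (st (i + 1)) (st i).
  by subst j.
case: i cast => n cast.
- apply: (cast _ (esym (eP n))); rewrite /=.
  have -> : eq_rect n.+1%:Z S (eq_rect (n%:Z + 1) S (up n (a n)) n.+1 (eP n)) (n%:Z + 1) (esym (eP n)) = up n (a n).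
    by case: _ / (eP n).
  exact: upP.
- apply: (cast _ (eN n)).
  have -> : st (Nz n) = b n by case: n {cast}.
  exact: dnP.
Qed.

Section Gorenstein.
Variable R : pzRingType.
Notation cx := (int_sequence R).
Notation tm A f := (tensor_map (idl A) f) (only parsing).

(** One step, read leftwards or rightwards, of the resolutions and coresolutions that
make a module Gorenstein AC-flat. *)
Definition flat_step (N' F N : lmodType R) (io : {linear N' -> F}) (p : {linear F -> N}) : Prop :=
  [/\ flat F, injective io, exact io p, surj p &
      forall A, test_module A -> injective (tensor_map (idl A) io)].

Lemma assemble (N F : int -> lmodType R) (io : forall i, {linear N (i + 1) -> F i})
  (p : forall i, {linear F i -> N i}) :
  (forall i, flat_step (io i) (p i)) ->
  acflat (IntSequence (fun i => io i \o p (i + 1))) /\ forall i, exact (io i \o p (i + 1)) (p i).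
Proof.
move=> h.
have ex i : exact (io i \o p (i + 1)) (p i).
  have [_ _ e _ _] := h i; have [_ _ _ s _] := h (i + 1).
  move=> y; split=> [/e [n <-]|[x <-]]; last by apply/e; exists (p (i + 1) x).
  by have [x <-] := s n; exists x.
split=> //; split=> [i|A hA i t]; first by case: (h i).
have [_ _ e s _] := h (i + 1); have [_ _ _ _ inj] := h i.
have tE k (u : tensor A (F (k + 1))) : tm A (io k \o p (k + 1)) u = tm A (io k) (tm A (p (k + 1)) u).
  by apply/esym/tmap_comp.
have te := texact_r (A := A) (ex (i + 1)) s t.
split=> ht; first by apply/te; apply: (inj A hA); rewrite tmap0 -tE.
by move/te: ht => /= ht; rewrite (tE i) ht tmap0.
Qed.

Definition is_coker (X : cx) i (N : lmodType R) (q : {linear X i -> N}) : Prop :=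
  surj q /\ exact (seq_d X i) q.

Lemma coker_GF (X : cx) i (N : lmodType R) (q : {linear X i -> N}) :
  acflat X -> is_coker q -> GF_ac N.
Proof.
move=> gX; have [k ek] : exists k : int, i = k + 1 + 1 by exists (i - 1 - 1); rewrite !subrK.
subst i => -[sq eq].
have eX := acflat_exact gX.
have [j hj] : exists j : {linear N -> X (k + 1)}, forall x, j (q x) = seq_d X (k + 1) x.
  by apply: surj_factor => // x /eq [y <-]; apply: acflat_dd.
exists X; split=> //; [exact: gX.1|by move=> A hA; apply: gX.2; left|].
exists k, j; split.
  apply: linj => n; have [x <-] := sq n; rewrite hj => /eX hx.
  by apply/eq.
move=> y; split=> [/eX [x <-]|[n <-]]; first by exists (q x).
by have [x <-] := sq n; rewrite hj; apply: acflat_dd.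
Qed.

Lemma coker_step (X : cx) k (N N0 : lmodType R) (q : {linear X (k + 1) -> N})
  (p : {linear X k -> N0}) :
  acflat X -> is_coker q -> is_coker p -> exists io : {linear N -> X k}, flat_step io p.
Proof.
move=> gX [sq eq] [sp ep]; have eX := acflat_exact gX.
have [j hj] : exists j : {linear N -> X k}, forall x, j (q x) = seq_d X k x.
  by apply: surj_factor => // x /eq [y <-]; apply: acflat_dd.
exists j; split=> //.
- exact: gX.1.
- apply: linj => n; have [x <-] := sq n; rewrite hj => /eX hx; exact/eq.
- move=> y; split=> [/ep [x <-]|[n <-]]; first by exists (q x).
  by have [x <-] := sq n; rewrite hj; apply/ep; exists x.
- move=> A hA; apply: inj0P => t ht.
  have [u eu] := tsurj_r (A := A) sq t; subst t.
  have {}ht : tm A (seq_d X k) u = 0.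
    by rewrite -[RHS]ht; apply/esym/tmap_comp.
  by apply/(texact_r (A := A) eq sq); apply/(gX.2 A hA k).
Qed.

Lemma qpi_coker (X : cx) i : is_coker (qpi (imgm (seq_d X i))).
Proof. by split; [exact: qpi_surj|move=> x; apply: qpi0P]. Qed.

Definition has_coker (N : lmodType R) : Prop :=
  exists (X : cx) i (q : {linear X i -> N}), acflat X /\ is_coker q.

(** Splicing the short exact sequences that a module of G starts and ends gives a
complex with the given module as a cokernel. *)
Lemma coinduction (G : lmodType R -> Prop) :
  (forall N, G N -> exists (N' F : lmodType R) (io : {linear N' -> F}) (p : {linear F -> N}), G N' /\ flat_step io p) ->
  (forall N', G N' -> exists (F N : lmodType R) (io : {linear N' -> F}) (p : {linear F -> N}), G N /\ flat_step io p) ->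
  forall N, G N -> exists (X : cx) (q : {linear X 0 -> N}), acflat X /\ is_coker q.
Proof.
move=> hl hr N0 GN0.
pose S (_ : int) := {N | G N}.
pose rho i (s' : S (i + 1)) (s : S i) := exists (F : lmodType R) (io : {linear proj1_sig s' -> F})
  (p : {linear F -> proj1_sig s}), flat_step io p.
have [i [N GN]|i [N GN]|st [e0 hst]] := @int_chain S rho (exist _ N0 GN0).
- by have [N' [F [io [p [G' h]]]]] := hl N GN; exists (exist _ N' G'), F, io, p.
- by have [F [N' [io [p [G' h]]]]] := hr N GN; exists (exist _ N' G'), F, io, p.
have [F hF] := dep_choice hst; have [io hio] := dep_choice hF; have [p hp] := dep_choice hio.
have [gX ex] := @assemble (fun i => proj1_sig (st i)) F io p hp.
have [_ _ _ s _] := hp 0.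
have -> : N0 = proj1_sig (st 0) by rewrite e0.
by exists (IntSequence (fun i => io i \o p (i + 1))), (p 0); split=> //; split.
Qed.

Lemma has_coker_left (N : lmodType R) : has_coker N ->
  exists (N' F : lmodType R) (io : {linear N' -> F}) (p : {linear F -> N}), has_coker N' /\ flat_step io p.
Proof.
move=> [X [i [q [gX cq]]]].
have [io hio] := coker_step gX (qpi_coker X (i + 1)) cq.
exists (quot (imgm (seq_d X (i + 1)))), (X i), io, q; split=> //.
by exists X, (i + 1), (qpi _); split=> //; apply: qpi_coker.
Qed.

Lemma has_coker_right (N : lmodType R) : has_coker N ->
  exists (F N' : lmodType R) (io : {linear N -> F}) (p : {linear F -> N'}), has_coker N' /\ flat_step io p.
Proof.
move=> [X [i [q [gX cq]]]].
have [k ek] : exists k : int, i = k + 1 by exists (i - 1); rewrite subrK.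
subst i; have [io hio] := coker_step gX cq (qpi_coker X k).
exists (X k), (quot (imgm (seq_d X k))), io, (qpi _); split=> //.
by exists X, k, (qpi _); split=> //; apply: qpi_coker.
Qed.

(** The cycles in degree i + 1 are the cokernel of the differential that arrives in
degree i + 1 + 1. *)
Lemma has_coker_GF (N : lmodType R) : has_coker N <-> GF_ac N.
Proof.
split=> [[X [i [q [gX cq]]]]|[F [fF eF tF [i [j [ji je]]]]]]; first exact: coker_GF gX cq.
have gF : acflat F by split=> // A [/tF //|->]; apply/rreg_exact.
have [q hq] : exists q : {linear F (i + 1 + 1) -> N}, forall x, j (q x) = seq_d F (i + 1) x.
  by apply: inj_factor => // x; apply/je/eF; exists x.
exists F, (i + 1 + 1), q; split=> //; split=> [n|x].
  have /eF [x hx] : seq_d F i (j n) = 0 by apply/je; exists n.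
  by exists x; apply: ji; rewrite hq.
split=> [h|/eF hx]; last by apply: ji; rewrite linear0 hq.
by apply/eF; rewrite -hq h linear0.
Qed.

Lemma GF_coker0 (N : lmodType R) : GF_ac N -> exists (X : cx) (q : {linear X 0 -> N}), acflat X /\ is_coker q.
Proof. by move=> /has_coker_GF; apply: coinduction; [exact: has_coker_left|exact: has_coker_right]. Qed.

Lemma GF_left (N : lmodType R) : GF_ac N ->
  exists (N' F : lmodType R) (io : {linear N' -> F}) (p : {linear F -> N}), GF_ac N' /\ flat_step io p.
Proof.
by move=> /has_coker_GF /has_coker_left [N' [F [io [p [/has_coker_GF h s]]]]]; exists N', F, io, p.
Qed.
Lemma GF_right (N : lmodType R) : GF_ac N ->
  exists (F N' : lmodType R) (io : {linear N -> F}) (p : {linear F -> N'}), GF_ac N' /\ flat_step io p.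
Proof.
by move=> /has_coker_GF /has_coker_right [N' [F [io [p [/has_coker_GF h s]]]]]; exists N', F, io, p.
Qed.

Section Prod.
Variables (M N : lmodType R).
Fact in1_lin : linear (fun m : M => (m, 0) : (M * N)%type).
Proof. by move=> a x y; rewrite -[RHS]/(a *: x + y, a *: 0 + 0) scaler0 addr0. Qed.
Definition in1 : {linear M -> (M * N)%type} := mklin in1_lin.
Fact in2_lin : linear (fun m : N => (0, m) : (M * N)%type).
Proof. by move=> a x y; rewrite -[RHS]/(a *: 0 + 0, a *: x + y) scaler0 addr0. Qed.
Definition in2 : {linear N -> (M * N)%type} := mklin in2_lin.
Fact pr1_lin : linear (fun m : (M * N)%type => m.1). Proof. by []. Qed.
Definition pr1 : {linear (M * N)%type -> M} := mklin pr1_lin.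
Fact pr2_lin : linear (fun m : (M * N)%type => m.2). Proof. by []. Qed.
Definition pr2 : {linear (M * N)%type -> N} := mklin pr2_lin.
Lemma in1E m : in1 m = (m, 0). Proof. exact: mklinE. Qed.
Lemma in2E m : in2 m = (0, m). Proof. exact: mklinE. Qed.
Lemma pr1E m : pr1 m = m.1. Proof. exact: mklinE. Qed.
Lemma pr2E m : pr2 m = m.2. Proof. exact: mklinE. Qed.

Lemma tprod_eq0 (A : lmodType R^c) (t : tensor A (M * N)%type) :
  tm A pr1 t = 0 -> tm A pr2 t = 0 -> t = 0.
Proof.
have <- : tm A in1 (tm A pr1 t) + tm A in2 (tm A pr2 t) = t.
  have [L ->] := tens_list t; rewrite !tmap_sum -big_split; apply: eq_bigr => p _.
  transitivity (tens p.1 (in1 (pr1 p.2) + in2 (pr2 p.2))); first exact/esym/tensDr.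
  rewrite in1E in2E pr1E pr2E; congr tens.
  by case: (p.2) => m n; rewrite -[LHS]/(m + 0, 0 + n) addr0 add0r.
have id1 u : tm A pr1 (tm A in1 u) = u.
  rewrite (tmap_comp (h := idl A) (k := idl M)) // => [|m]; last by rewrite pr1E in1E.
  exact: tmap_id.
have id2 u : tm A pr2 (tm A in2 u) = u.
  rewrite (tmap_comp (h := idl A) (k := idl N)) // => [|m]; last by rewrite pr2E in2E.
  exact: tmap_id.
have z1 u : tm A pr1 (tm A in2 u) = 0.
  rewrite (tmap_comp (h := idl A) (k := \0)) // => [|m]; last by rewrite pr1E in2E.
  exact: tmap_0.
have z2 u : tm A pr2 (tm A in1 u) = 0.
  rewrite (tmap_comp (h := idl A) (k := \0)) // => [|m]; last by rewrite pr2E in1E.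
  exact: tmap_0.
have e1 u v : tm A pr1 (tm A in1 u + tm A in2 v) = u by rewrite tmapD id1 z1 addr0.
have e2 u v : tm A pr2 (tm A in1 u + tm A in2 v) = v by rewrite tmapD id2 z2 add0r.
by rewrite e1 e2 => -> ->; rewrite !tmap0 addr0.
Qed.

Lemma flat_prod : flat M -> flat N -> flat (M * N)%type.
Proof.
move=> fM fN; apply: flat_of_inj => A B f fi t h.
apply: tprod_eq0.
  apply: (flat_inj fM fi); rewrite tmap0.
  by rewrite (tmap_comm (h := f) (k := idl _) (h' := idl B) (k' := pr1)) // h tmap0.
apply: (flat_inj fN fi); rewrite tmap0.
by rewrite (tmap_comm (h := f) (k := idl _) (h' := idl B) (k' := pr2)) // h tmap0.
Qed.
End Prod.

(** Splice copies of the split sequence 0 -> N -> N x N -> N -> 0. *)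
Lemma flat_GF (M : lmodType R) : flat M -> GF_ac M.
Proof.
have st (N : lmodType R) : flat N -> flat_step (in1 N N) (pr2 N N).
  move=> fN; split.
  - exact: flat_prod.
  - by move=> x y; rewrite !in1E => -[].
  - move=> [x y]; rewrite pr2E; split=> [/= ->|[z]]; first by exists x; rewrite in1E.
    by rewrite in1E => -[_ ->].
  - by move=> y; exists (0, y); rewrite pr2E.
  - move=> A _ u v e.
    have r w : tm A (pr1 N N) (tm A (in1 N N) w) = w.
      rewrite (tmap_comp (h := idl A) (k := idl N)) // => [|m]; last by rewrite pr1E in1E.
      exact: tmap_id.
    by rewrite -(r u) e r.
move=> fM; have [||X [q [gX cq]]] := @coinduction (fun N => flat N) _ _ M fM.
- by move=> N fN; exists N, (N * N)%type, (in1 N N), (pr2 N N); split=> //; apply: st.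
- by move=> N fN; exists (N * N)%type, N, (in1 N N), (pr2 N N); split=> //; apply: st.
exact: coker_GF gX cq.
Qed.
End Gorenstein.

(** * Extending maps along complexes *)

Section Extend.
Variable R : pzRingType.
Notation cx := (int_sequence R).
Notation tm A f := (tensor_map (idl A) f) (only parsing).
Hypothesis ext : closed_under_extensions (@GF_ac R).

(** Let 0 -> N0 -> W -> N -> 0 start a flat resolution of N.  Then W x X i maps onto
N, and the kernel N' is the pullback of W and X i over N; it is an extension of
the flat module X i by N0. *)
Lemma extend_left (X : cx) i (N : lmodType R) (v : {linear X i -> N}) :
  acflat X -> GF_ac N -> (forall x, v (seq_d X i x) = 0) ->
  exists (N' F : lmodType R) (v' : {linear X (i + 1) -> N'}) (io : {linear N' -> F})
    (p : {linear F -> N}) (g : {linear X i -> F}),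
  [/\ GF_ac N', flat_step io p, forall x, v' (seq_d X (i + 1) x) = 0,
      forall x, p (g x) = v x & forall x, g (seq_d X i x) = io (v' x)].
Proof.
move=> gX /GF_left [N0 [W [io0 [p0 [GN0 [fW io0i e0 s0 t0]]]]]] vd.
have pl : linear (fun w : (W * X i)%type => p0 w.1 + v w.2).
  move=> a [x1 x2] [y1 y2].
  by rewrite -[X in X = _]/(p0 (a *: x1 + y1) + v (a *: x2 + y2)) !linearP /= scalerDr addrACA.
pose p := mklin pl; have pE w : p w = p0 w.1 + v w.2 by apply: mklinE.
have [v' hv'] : exists v' : {linear X (i + 1) -> subm (kerm p)},
    forall x, sincl (kerm p) (v' x) = (in2 W (X i) \o seq_d X i) x.
  apply: inj_factor => [|x]; first exact: sincl_inj.
  by apply: sincl_ex; rewrite /= in2E pE /= linear0 add0r.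
have [a ha] : exists a : {linear N0 -> subm (kerm p)},
    forall x, sincl (kerm p) (a x) = (in1 W (X i) \o io0) x.
  apply: inj_factor => [|x]; first exact: sincl_inj.
  apply: sincl_ex; rewrite /= in1E pE /= linear0 addr0.
  by apply/e0; exists x.
pose b : {linear subm (kerm p) -> X i} := pr2 W (X i) \o sincl (kerm p).
have bE n : b n = (sincl (kerm p) n).2 by rewrite /b /= pr2E.
have kp n : p0 (sincl (kerm p) n).1 + v (sincl (kerm p) n).2 = 0.
  by rewrite -pE; apply: (sinclP n).
have ai : injective a.
  apply: linj => n hn; have := ha n; rewrite hn linear0 /= in1E => -[e].
  by apply: io0i; rewrite linear0.
have ab : exact a b.
  move=> n; rewrite bE; split=> [h|[m <-]]; last by rewrite ha /= in1E.
  have := kp n; rewrite h linear0 addr0 => /e0 [m hm].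
  exists m; apply: (@sincl_inj _ _ (kerm p)); rewrite ha /= in1E hm -h.
  by case: (sincl _ n).
have sb : surj b.
  move=> x; have [w hw] := s0 (- v x).
  have /sincl_ex [n hn] : kerm p (w, x) by rewrite /= pE /= hw addNr.
  by exists n; rewrite bE hn.
exists (subm (kerm p)), (W * X i)%type, v', (sincl (kerm p)), p, (in2 W (X i)); split.
- apply: (ext ai ab sb GN0); apply: flat_GF; exact: gX.1.
- split.
  + apply: flat_prod => //; exact: gX.1.
  + exact: sincl_inj.
  + by move=> w; split=> [h|[n <-]]; [apply: (@sincl_ex _ _ (kerm p))|apply: (sinclP n)].
  + by move=> n; have [w <-] := s0 n; exists (w, 0); rewrite pE /= linear0 addr0.
  + move=> A hA; apply: inj0P => t ht.
    have bt : tm A b t = 0.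
      rewrite -(tmap_comp (g := idl A) (f := sincl (kerm p)) (g' := idl A) (f' := pr2 W (X i))) //.
      by have -> : tm A (sincl (kerm p)) t = 0 by []; rewrite tmap0.
    have /(texact_r (A := A) ab sb) [n hn] := bt; subst t.
    suff -> : n = 0 by rewrite tmap0.
    apply: (t0 A hA); rewrite tmap0.
    have <- : tm A (pr1 W (X i) \o sincl (kerm p)) (tm A a n) = tm A io0 n.
      by apply: tmap_comp => // m; rewrite /= ha /= in1E pr1E.
    rewrite -(tmap_comp (g := idl A) (f := sincl (kerm p)) (g' := idl A) (f' := pr1 W (X i))) //.
    by have -> : tm A (sincl (kerm p)) (tm A a n) = 0 by []; rewrite tmap0.
- move=> x; apply: (@sincl_inj _ _ (kerm p)).
  by rewrite hv' /= in2E acflat_dd // linear0.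
- by move=> x; rewrite pE in2E /= linear0 add0r.
- by move=> x; rewrite hv'.
Qed.

(** The pushout P of N and X i under X (i + 1) is an extension of the cokernel of
X (i + 1) -> X i by N, hence embeds into a flat F with Gorenstein AC-flat
cokernel N2.  The quotient of F by N is then an extension of N2 by that
cokernel. *)
Lemma extend_right (X : cx) i (N : lmodType R) (v : {linear X (i + 1) -> N}) :
  acflat X -> GF_ac N -> (forall x, v (seq_d X (i + 1) x) = 0) ->
  exists (F N0 : lmodType R) (v0 : {linear X i -> N0}) (io : {linear N -> F})
    (p : {linear F -> N0}) (g : {linear X i -> F}),
  [/\ GF_ac N0, flat_step io p, forall x, v0 (seq_d X i x) = 0,
      forall x, p (g x) = v0 x & forall x, g (seq_d X i x) = io (v x)].
Proof.
move=> gX GN vd; have eX := acflat_exact gX.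
pose ka : {linear X (i + 1) -> (N * X i)%type} :=
  (in1 N (X i) \o v) \- (in2 N (X i) \o seq_d X i).
have kaE x : ka x = (v x, - seq_d X i x).
  rewrite -[LHS]/(in1 N (X i) (v x) - in2 N (X i) (seq_d X i x)) in1E in2E.
  by rewrite -[LHS]/(v x - 0, 0 - seq_d X i x) subr0 sub0r.
pose P := quot (imgm ka); pose pi : {linear (N * X i)%type -> P} := qpi (imgm ka).
pose al : {linear N -> P} := pi \o in1 N (X i).
pose be : {linear X i -> P} := pi \o in2 N (X i).
have alE n : al n = pi (n, 0) by rewrite /al /= in1E.
have beE x : be x = pi (0, x) by rewrite /be /= in2E.
have abE n x : pi (n, x) = al n + be x.
  by rewrite alE beE -linearD; congr (pi _); rewrite -[RHS]/(n + 0, 0 + x) addr0 add0r.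
have eqP0 n x : al n = be x <-> exists y, v y = n /\ seq_d X i y = x.
  rewrite alE beE; split=> [/qpiP [y]|[y [<- <-]]].
    rewrite kaE -[X in _ = X]/(n - 0, 0 - x) subr0 sub0r => -[h1 /oppr_inj h2].
    by exists y.
  by apply/qpiP; exists y; rewrite kaE -[RHS]/(v y - 0, 0 - seq_d X i y) subr0 sub0r.
have abd x : be (seq_d X i x) = al (v x) by apply/esym/eqP0; exists x.
pose Ck := quot (imgm (seq_d X i)); pose pc : {linear X i -> Ck} := qpi _.
have cpc : is_coker pc by apply: qpi_coker.
have GCk : GF_ac Ck by apply: coker_GF gX cpc.
have [ep hep] : exists ep : {linear P -> Ck}, forall w, ep (pi w) = (pc \o pr2 N (X i)) w.
  apply: surj_factor => [|w /qpi0P [y <-]]; first exact: qpi_surj.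
  by rewrite kaE /= pr2E /= linearN; apply/eqP; rewrite oppr_eq0; apply/eqP/cpc.2; exists y.
have ali : injective al.
  apply: linj => n; rewrite -(linear0 be) => /eqP0 [y [<- /eX [z <-]]]; exact: vd.
have eae : exact al ep.
  move=> w; split=> [|[n <-]]; last by rewrite alE hep /= pr2E linear0.
  have [[n x] <-] := qpi_surj w; rewrite hep /= pr2E => /cpc.2 [y /= hy].
  by exists (n + v y); rewrite abE -hy abd; apply: (linearD al).
have sep : surj ep.
  by move=> u; have [x <-] := cpc.1 u; exists (pi (0, x)); rewrite hep /= pr2E.
have GP : GF_ac P by apply: (ext ali eae sep GN GCk).
have [F [N2 [ga [de [GN2 [fF gai ega sde tga]]]]]] := GF_right GP.
pose io : {linear N -> F} := ga \o al.
pose N0 := quot (imgm io); pose p : {linear F -> N0} := qpi (imgm io).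
pose g : {linear X i -> F} := ga \o be.
have gd x : g (seq_d X i x) = io (v x).
  by rewrite -[LHS]/(ga (be (seq_d X i x))) abd.
have pio n : p (io n) = 0 by apply/qpi0P; exists n.
have [l hl] : exists l : {linear Ck -> N0}, forall x, l (pc x) = (p \o g) x.
  apply: surj_factor; first exact: cpc.1.
  by move=> x /cpc.2 [y <-]; rewrite -[LHS]/(p (g (seq_d X i y))) gd pio.
have [e he] : exists e : {linear N0 -> N2}, forall y, e (p y) = de y.
  apply: surj_factor => [|y /qpi0P [n <-]]; first exact: qpi_surj.
  by apply/ega; exists (al n).
have li : injective l.
  apply: linj => u; have [x <-] := cpc.1 u; rewrite hl => /qpi0P [n /gai /eqP0 [y [_ <-]]].
  by apply/cpc.2; exists y.
have ele : exact l e.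
  move=> w; split=> [|[u <-]].
    have [y <-] := qpi_surj w; rewrite he => /ega [q <-].
    have [[n x] <-] := qpi_surj q; exists (pc x).
    by rewrite hl abE !linearD -[ga (al n)]/(io n) pio add0r.
  by have [x <-] := cpc.1 u; rewrite hl he; apply/ega; exists (be x).
have se : surj e by move=> u; have [y <-] := sde u; exists (p y).
exists F, N0, (p \o g), io, p, g; split=> //.
- exact: (ext li ele se GCk GN2).
- split=> //.
  + by move=> n n' /gai /ali.
  + by move=> y; apply: qpi0P.
  + exact: qpi_surj.
  move=> A hA; apply: inj0P => t ht.
  have h1 : tm A al t = 0.
    apply: (tga A hA); rewrite tmap0 -[RHS]ht; exact: tmap_comp.
  have h2 : tm A pi (tm A (in1 N (X i)) t) = 0 by rewrite -[RHS]h1; apply: tmap_comp.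
  have [s hs] : exists s, tm A ka s = tm A (in1 N (X i)) t.
    by apply: tspan_img_r (tker_r (@qpi_surj _ _ _) h2) => _ w /qpi0P.
  have h3 : tm A (seq_d X i) s = 0.
    have e2 : tm A (pr2 N (X i)) (tm A ka s) = - tm A (seq_d X i) s.
      have [L ->] := tens_list s; rewrite !tmap_sum -sumrN; apply: eq_bigr => q _.
      by rewrite pr2E kaE /= tensNr.
    apply/eqP; rewrite -oppr_eq0 -e2 hs; apply/eqP.
    rewrite (tmap_comp (h := idl A) (k := \0)) // => [|m]; last by rewrite pr2E in1E.
    exact: tmap_0.
  have [s' hs'] : exists s', tm A (seq_d X (i + 1)) s' = s by apply/(gX.2 A hA i).
  have <- : tm A (pr1 N (X i)) (tm A (in1 N (X i)) t) = t.
    rewrite (tmap_comp (h := idl A) (k := idl N)) // => [|m]; last by rewrite pr1E in1E.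
    exact: tmap_id.
  rewrite -hs (tmap_comp (h := idl A) (k := v)) // => [|m]; last by rewrite pr1E kaE.
  by rewrite -hs' (tmap_comp (h := idl A) (k := \0)) // tmap_0.
- by move=> x; rewrite -[LHS]/(p (g (seq_d X i x))) gd pio.
Qed.

(** The states of the construction are the maps v i from X i to the cokernel of Y in
degree i; [extend_left] and [extend_right] compute v (i + 1) from v i and v i from
v (i + 1). *)
Lemma extend_map (X : cx) (N : lmodType R) (v : {linear X 0 -> N}) :
  acflat X -> GF_ac N -> (forall x, v (seq_d X 0 x) = 0) ->
  exists (Y : cx) (g : cmap X Y) (q : {linear Y 0 -> N}),
    [/\ acflat Y, is_coker q & forall x, q (g 0 x) = v x].
Proof.
move=> gX GN vd.
pose ok i (N : lmodType R) (v : {linear X i -> N}) := GF_ac N /\ forall x, v (seq_d X i x) = 0.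
pose S (i : int) := {N : lmodType R & {v : {linear X i -> N} | ok i N v}}.
pose vS i (s : S i) : {linear X i -> projT1 s} := proj1_sig (projT2 s).
pose rho i (s' : S (i + 1)) (s : S i) := exists (F : lmodType R)
  (io : {linear projT1 s' -> F}) (p : {linear F -> projT1 s}) (g : {linear X i -> F}),
  [/\ flat_step io p, forall x, p (g x) = vS i s x &
      forall x, g (seq_d X i x) = io (vS (i + 1) s' x)].
pose s0 : S 0 := existT _ N (exist _ v (conj GN vd)).
have [i [N1 [v1 [GN1 vd1]]]|i [N1 [v1 [GN1 vd1]]]|st [e0 hst]] := @int_chain S rho s0.
- have [N' [F [v' [io [p [g [h1 h2 h3 h4 h5]]]]]]] := extend_left gX GN1 vd1.
  by exists (existT _ N' (exist _ v' (conj h1 h3))), F, io, p, g.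
- have [F [N' [v' [io [p [g [h1 h2 h3 h4 h5]]]]]]] := extend_right gX GN1 vd1.
  by exists (existT _ N' (exist _ v' (conj h1 h3))), F, io, p, g.
have [F hF] := dep_choice hst; have [io hio] := dep_choice hF.
have [p hp] := dep_choice hio; have [g hg] := dep_choice hp.
have hs i : flat_step (io i) (p i) by case: (hg i).
have [gY ex] := @assemble _ (fun i => projT1 (st i)) F io p hs.
pose Y : cx := IntSequence (fun i => io i \o p (i + 1)).
have gd i x : g i (seq_d X i x) = seq_d Y i (g (i + 1) x).
  have [_ _ ->] := hg i; by have [_ /= -> _] := hg (i + 1).
pose gc : cmap X Y := @CMap R X Y g gd.
have [[_ _ _ sp _] pg _] := hg 0.
have : exists q : {linear Y 0 -> projT1 (st 0)}, is_coker q /\ forall x, q (gc 0 x) = vS 0 (st 0) x.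
  by exists (p 0); split.
by rewrite e0 => -[q [cq qg]]; exists Y, gc, q.
Qed.

Theorem GF_covering : covering (@GF_ac R).
Proof.
move=> M.
have [C [wC aC]] := cover_exists 0 M.
pose Z := quot (imgm (seq_d C 0)); pose z : {linear C 0 -> Z} := qpi _.
have cz : is_coker z by apply: qpi_coker.
have GZ : GF_ac Z by apply: coker_GF (ogood C) cz.
have [phi hphi] : exists phi : {linear Z -> M}, forall x, phi (z x) = opsi C x.
  by apply: surj_factor; [exact: cz.1|move=> x /cz.2 [y <-]; apply: opsi_d].
(* A map over M from the cokernel N of Y comes from a chain map over M, because
   C is weakly terminal. *)
have ind (Y : cx) (N : lmodType R) (q : {linear Y 0 -> N}) (psi : {linear N -> M}) :
    acflat Y -> is_coker q -> exists (h : cmap Y C) (hb : {linear N -> Z}),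
    [/\ forall y, hb (q y) = z (h 0 y), forall n, phi (hb n) = psi n &
        forall y, opsi C (h 0 y) = psi (q y)].
  move=> gY [sq eq].
  have pd y : (psi \o q) (seq_d Y 0 y) = 0.
    by rewrite /= (_ : q _ = 0) ?linear0 //; apply/eq; exists y.
  have [h oh] := wC (@OverCx R 0 M Y (psi \o q) pd gY).
  have [hb hhb] : exists hb : {linear N -> Z}, forall y, hb (q y) = (z \o h 0) y.
    apply: surj_factor => // y /eq [w <-]; rewrite /= cmd; apply/cz.2.
    by exists (h (0 + 1) w).
  exists h, hb; split=> // n; have [y <-] := sq n.
  by rewrite hhb /= hphi oh.
have linv (f : {linear Z -> Z}) : (forall x, phi (f x) = phi x) ->
    exists h : {linear Z -> Z}, (forall x, phi (h x) = phi x) /\ forall x, h (f x) = x.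
  move=> of_.
  have [|Y [g [q [gY cq qg]]]] := @extend_map C Z (f \o z) (ogood C) GZ.
    by move=> x; rewrite /= (_ : z _ = 0) ?linear0 //; apply/cz.2; exists x.
  have [h [hb [h1 h2 h3]]] := ind Y Z q phi gY cq.
  have oe : is_over (cmap_comp h g : cmap C C).
    by move=> x; rewrite /= h3 qg /= of_ hphi.
  have ae := aC _ oe.
  have hbf x : hb (f (z x)) = z (h 0 (g 0 x)) by rewrite -h1 qg.
  (* On cokernels, the automorphism h g of C over M induces hb f. *)
  have inj : injective (hb \o f).
    apply: linj => w; have [x <-] := cz.1 w; rewrite /= hbf => /cz.2 [y hy].
    have [y' hy'] := (ae (0 + 1)).2 y; apply/cz.2; exists y'.
    by apply: (ae 0).1; rewrite (cmd (cmap_comp h g)) hy'.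
  have sur w : exists w', (hb \o f) w' = w.
    have [x <-] := cz.1 w; have [x' hx'] := (ae 0).2 x.
    by exists (z x'); rewrite /= hbf -hx'.
  have [k hk] : exists k : {linear Z -> Z}, forall x, (hb \o f) (k x) = (idl Z) x.
    by apply: inj_factor => // w; apply: sur.
  have {}hk x : hb (f (k x)) = x := hk x.
  exists (k \o hb); split=> [x|x].
    by rewrite /= -[RHS]h2 -[in RHS](hk (hb x)) h2 of_.
  by apply: inj; rewrite /= hk.
exists Z, phi; split.
  split=> // N psi /GF_coker0 [Y [q [gY cq]]].
  by have [h [hb [_ h2 _]]] := ind Y N q psi gY cq; exists hb.
move=> f of_; have [h [oh hf]] := linv f of_; have [k [_ kh]] := linv h oh.
exists h => // x; apply: (can_inj kh); exact: hf.
Qed.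
End Extend.

Theorem proposition4p6 (R : pzRingType) :
  closed_under_extensions (@GF_ac R) -> covering (@GF_ac R).
Proof. exact: GF_covering. Qed.
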